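(* Consider the radial compressible Euler equations in $n>1$ dimensions with equation of state $p=p(\rho,S)$, $p\neq$ const. (i) For a general equation of state $p=p(\rho,S)$, all scalar invariants up to first order, i.e. of the form $J(t,r,U,\rho,S,U_r,\rho_r,S_r)$, are functions of $$S,\qquad r^{1-n}S_r/\rho .$$ (ii) The only special equation of state for which additional scalar invariants of the form $J(t,r,U,\rho,S,U_r,\rho_r,S_r)$ arise is the entropic case $p=\kappa(S)$, where $\kappa$ is an arbitrary non-constant function. In this case the additional invariants are functions of $$U^2+\tfrac{2}{n}\,r\,\kappa'(S)S_r/\rho,\qquad \int_0^r \frac{dy}{\sqrt{U^2+\tfrac{2}{n}\big(1-(y/r)^n\big)\,r\,\kappa'(S)S_r/\rho}}\;-\;t ,$$ so that all scalar invariants up to first order in the entropic case are functions of these two quantities together with $S$ and $r^{1-n}S_r/\rho$.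
   Context: Radial Euler equations: for functions $U(r,t)$ (radial velocity), $\rho(r,t)$ (density), $S(r,t)$ (entropy), with $r>0$ the radial coordinate in $\mathbb{R}^n$, $n>1$, $$U_t+UU_r+(p_S S_r+p_\rho\rho_r)/\rho=0,\quad \rho_t+(U\rho)_r+\tfrac{n-1}{r}U\rho=0,\quad S_t+US_r=0,$$ with equation of state $p=p(\rho,S)$. ''General equation of state'' means $p$ is an arbitrary (non-constant) function of $\rho,S$. $D_t$, $D_r$ denote total derivatives, acting by the chain rule on the fluid variables and their derivatives, and $|_{\mathcal E}$ means evaluation on the solution space, i.e. all $t$-derivatives are eliminated by means of the Euler equations, the resulting relation being required to hold identically in $t$, $r$, the fluid variables and their $r$-derivatives. A scalar invariant is a function $J$ of $t,r$, the fluid variables $U,\rho,S$ and finitely many of their $r$-derivatives such that $(D_tJ+U D_rJ)|_{\mathcal E}=0$. Its order is the highest order of $r$-derivative appearing in it.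
   Formalization: p is constant, or a function of S alone, on an open part of its domain only if it is so throughout; the root in the integral has the sign of U (the positive root is not invariant for U<0); claims involving the integral assume U≠0 and U²+(2/n)rκ'(S)S_r/ρ>0. *)

(* Defs.v *)
From Stdlib Require Import Reals Lra.
From Coquelicot Require Import Coquelicot.
Open Scope R_scope.

(** * Calculus in finitely many named real variables

    [I] is a finite enumeration of variable names and a point is a map [I -> R];
    on such maps the uniform structure of Coquelicot ([fct_UniformSpace]) is the
    sup distance, so [open] and [continuous] have their usual meaning in [R^I]. *)

Class EqDec (I : Type) := eq_dec : forall i j : I, {i = j} + {i <> j}.

Section Calculus.
Context {I : Type} {dec : EqDec I}.

Definition upd (z : I -> R) (i : I) (x : R) : I -> R :=
  fun j => if eq_dec j i then x else z j.

Definition partial (i : I) (f : (I -> R) -> R) (z : I -> R) : R :=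
  Derive (fun x => f (upd z i x)) (z i).

Definition ex_partial (i : I) (f : (I -> R) -> R) (z : I -> R) : Prop :=
  ex_derive (fun x => f (upd z i x)) (z i).

Definition C1_on (A : (I -> R) -> Prop) (f : (I -> R) -> R) : Prop :=
  open A /\
  forall z i, A z -> ex_partial i f z /\ continuous (partial i f) z.

End Calculus.

Definition subset {T : Type} (A B : T -> Prop) : Prop := forall x, A x -> B x.
Definition nonempty {T : Type} (A : T -> Prop) : Prop := exists x, A x.

(** * First-order jets [(t, r, U, rho, S, U_r, rho_r, S_r)] *)

Inductive coord : Type :=
  c_t | c_r | c_U | c_rho | c_S | c_Ur | c_rhor | c_Sr.

#[global] Instance coord_eq_dec : EqDec coord.
Proof. intros i j; decide equality. Defined.

Definition jet : Type := coord -> R.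

(** Total derivatives of a function of first-order jets.  The extra arguments
    are the jet variables of one order higher that occur in them. *)

Definition D_r (f : jet -> R) (z : jet) (Urr rhorr Srr : R) : R :=
  partial c_r f z
  + z c_Ur * partial c_U f z + z c_rhor * partial c_rho f z
  + z c_Sr * partial c_S f z
  + Urr * partial c_Ur f z + rhorr * partial c_rhor f z
  + Srr * partial c_Sr f z.

Definition D_t (f : jet -> R) (z : jet) (Ut rhot St Utr rhotr Str : R) : R :=
  partial c_t f z
  + Ut * partial c_U f z + rhot * partial c_rho f z + St * partial c_S f z
  + Utr * partial c_Ur f z + rhotr * partial c_rhor f z
  + Str * partial c_Sr f z.

(** The radial Euler equations in [R^n], solved for the [t]-derivatives;
    the equation of state is [p rho S]. *)

Definition euler_U (p : R -> R -> R) (z : jet) : R :=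
  - (z c_U * z c_Ur
     + (Derive (fun S => p (z c_rho) S) (z c_S) * z c_Sr
        + Derive (fun rho => p rho (z c_S)) (z c_rho) * z c_rhor) / z c_rho).

Definition euler_rho (n : nat) (z : jet) : R :=
  - ((z c_Ur * z c_rho + z c_U * z c_rhor)
     + (INR n - 1) / z c_r * z c_U * z c_rho).

Definition euler_S (z : jet) : R := - (z c_U * z c_Sr).

(** [(D_t J + U D_r J)] on the solution space: [U_t, rho_t, S_t] are replaced
    by the right-hand sides above and [U_tr, rho_tr, S_tr] by their total
    [r]-derivatives. *)

Definition material_derivative (n : nat) (p : R -> R -> R) (J : jet -> R)
    (z : jet) (Urr rhorr Srr : R) : R :=
  D_t J z (euler_U p z) (euler_rho n z) (euler_S z)
      (D_r (euler_U p) z Urr rhorr Srr)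
      (D_r (euler_rho n) z Urr rhorr Srr)
      (D_r euler_S z Urr rhorr Srr)
  + z c_U * D_r J z Urr rhorr Srr.

Definition scalar_invariant (n : nat) (p : R -> R -> R)
    (Omega : jet -> Prop) (J : jet -> R) : Prop :=
  C1_on Omega J /\
  forall z, Omega z -> forall Urr rhorr Srr : R,
    material_derivative n p J z Urr rhorr Srr = 0.

(** * Functional dependence on given invariants *)

Definition function_of {I : Type} {dec : EqDec I}
    (Omega : jet -> Prop) (inv : jet -> I -> R) (J : jet -> R) : Prop :=
  exists (O : (I -> R) -> Prop) (F : (I -> R) -> R),
    C1_on O F /\ forall z, Omega z -> O (inv z) /\ J z = F (inv z).

(** On a domain in which the level sets of [inv] are disconnected, an invariant
    can only be expected to be a function of [inv] near each point. *)
Definition locally_function_of {I : Type} {dec : EqDec I}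
    (Omega : jet -> Prop) (inv : jet -> I -> R) (J : jet -> R) : Prop :=
  forall z, Omega z ->
    exists V : jet -> Prop, open V /\ V z /\ subset V Omega /\ function_of V inv J.

(** * Equations of state on a set [D] of pairs [(rho, S)] *)

Definition eos_domain (D : R * R -> Prop) : Prop :=
  open D /\
  (forall rho S, D (rho, S) -> 0 < rho) /\
  (forall rho1 rho2 rho S, D (rho1, S) -> D (rho2, S) ->
     rho1 <= rho <= rho2 -> D (rho, S)).

Definition C2_eos (D : R * R -> Prop) (p : R -> R -> R) : Prop :=
  forall rho S, D (rho, S) -> ex_diff_n p 2 rho S.

Definition constant_eos (D : R * R -> Prop) (p : R -> R -> R) : Prop :=
  exists c : R, forall rho S, D (rho, S) -> p rho S = c.

Definition entropic_with (kappa : R -> R) (D : R * R -> Prop) (p : R -> R -> R)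
  : Prop := forall rho S, D (rho, S) -> p rho S = kappa S.

Definition entropic_eos (D : R * R -> Prop) (p : R -> R -> R) : Prop :=
  exists kappa : R -> R, entropic_with kappa D p.

(** The type of the equation of state is the same in every part of [D], as is
    automatic for an analytic [p] on a connected [D].  Without this, a smooth
    [p] could be, say, constant for some values of [S] and not for others, and
    a classification of [p] would only make sense on each part separately. *)
Definition uniform_type (D : R * R -> Prop) (p : R -> R -> R) : Prop :=
  forall D' : R * R -> Prop, open D' -> nonempty D' -> subset D' D ->
    (constant_eos D' p -> constant_eos D p) /\
    (entropic_eos D' p -> entropic_eos D p).

(** The jets over [D]; all variables other than [r], [rho], [S] are free. *)
Definition jets_over (D : R * R -> Prop) : jet -> Prop :=
  fun z => 0 < z c_r /\ D (z c_rho, z c_S).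

(** * The invariants *)

Definition inv_S (z : jet) : R := z c_S.

(** [r^(1-n) S_r / rho] *)
Definition inv_Sr (n : nat) (z : jet) : R :=
  z c_Sr / (z c_r ^ (n - 1) * z c_rho).

Inductive basic_index : Type := b_S | b_Sr.

#[global] Instance basic_index_eq_dec : EqDec basic_index.
Proof. intros i j; decide equality. Defined.

Definition basic_invariants (n : nat) (z : jet) (i : basic_index) : R :=
  match i with b_S => inv_S z | b_Sr => inv_Sr n z end.

Definition additional_invariant (n : nat) (p : R -> R -> R)
    (Omega : jet -> Prop) (J : jet -> R) : Prop :=
  scalar_invariant n p Omega J /\
  ~ locally_function_of Omega (basic_invariants n) J.

Definition inv_energy (n : nat) (kappa : R -> R) (z : jet) : R :=
  z c_U ^ 2 + 2 / INR n * z c_r * Derive kappa (z c_S) * z c_Sr / z c_rho.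

(** The square root in the integrand stands for the velocity at radius [y], so
    it is the branch equal to [U] at [y = r]: the positive root if [0 < U], the
    negative one if [U < 0] (for which the positive root gives no invariant). *)
Definition inv_time (n : nat) (kappa : R -> R) (z : jet) : R :=
  RInt (fun y =>
          / (sign (z c_U)
             * sqrt (z c_U ^ 2
                     + 2 / INR n * (1 - (y / z c_r) ^ n) * z c_r
                       * Derive kappa (z c_S) * z c_Sr / z c_rho)))
       0 (z c_r)
  - z c_t.

(** The jets at which the integral in [inv_time] is a proper integral of a real
    function: the radicand is monotone in [y], with value [inv_energy] at
    [y = 0] and [U^2] at [y = r]. *)
Definition entropic_jets (n : nat) (kappa : R -> R) (D : R * R -> Prop)
  : jet -> Prop :=
  fun z => jets_over D z /\ z c_U <> 0 /\ 0 < inv_energy n kappa z.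

Inductive entropic_index : Type := e_S | e_Sr | e_energy | e_time.

#[global] Instance entropic_index_eq_dec : EqDec entropic_index.
Proof. intros i j; decide equality. Defined.

Definition entropic_invariants (n : nat) (kappa : R -> R) (z : jet)
    (i : entropic_index) : R :=
  match i with
  | e_S => inv_S z
  | e_Sr => inv_Sr n z
  | e_energy => inv_energy n kappa z
  | e_time => inv_time n kappa z
  end.

(* Main.v *)
Require Import Defs.
From Stdlib Require Import Reals Lra Lia List FunctionalExtensionality.
From Stdlib Require Import Classical ClassicalEpsilon.
From Coquelicot Require Import Coquelicot.
Open Scope R_scope.

(** On solutions the material derivative of [J] is the derivative of [J] along a vector
    on jets that is affine in the second-order jet variables.  Their coefficients give
    [J_rhor = 0] and [J_Ur p_rho = J_Ur p_S = 0], hence [J_Ur = 0], since the gradient of [p]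
    is nonzero on a dense set.  What remains is affine in [rhor] and [Ur], and yields
    [J_U p_rho = 0], the scaling equation [rho J_rho + Sr J_Sr = 0] and a transport equation
    along the flow.

    If [p] depends on [rho], then [J_U = 0], the transport equation splits in [U], and in the
    coordinate [w = r^(1-n) Sr / rho] in place of [Sr] only the [S] and [w] derivatives of [J]
    survive.  If [p = kappa S], the transport equation is solved by characteristics: with
    [E = U^2 + k r^n] and [k = (2/n) kappa'(S) w] constant along the flow, [dt/dr = 1/U] is
    integrated by [sg * RInt (fun y => / sqrt (E - k y^n)) 0 r - t], and in the coordinates
    [S, w, E] and this time only their derivatives of [J] survive.  In both cases the fibres of
    these coordinates are convex in the remaining coordinates, which gives functional
    dependence, locally on arbitrary domains and globally on the full ones. *)

(** * Continuously differentiable functions of named variables *)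

(** The obstacle is regularity. The determining equations already contain first derivatives of [J],
    and [J] is only continuously differentiable, so they cannot be differentiated again in [rhor],
    [Ur] or [U] to split off coefficients. Instead, once a partial derivative of [J] vanishes on the
    domain, [J] is locally independent of that variable, its other partials do not change when the
    variable moves, and subtracting the equation at two points isolates the coefficient. Likewise, a
    vanishing product such as [J_Ur p_rho] says nothing where [p_rho = 0]; there [uniform_type]
    excludes that the whole obstruction vanishes on an open set, and continuity of the partials of
    [J] does the rest. In the time invariant the radius is both an endpoint and a parameter under
    the root; the scaling [y = r x] moves everything into the one parameter [m = k r^n / E < 1] over
    the fixed interval from 0 to 1, so that smoothness and the transport equation become statements
    on one function of one variable. Since [E] determines [U] only up to sign, the entropic
    coordinates are inverted on each sign of [U] separately. *)

Section C1Functions.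
Context {I : Type} {dec : EqDec I}.
Implicit Types (z : I -> R) (A B : (I -> R) -> Prop) (f g : (I -> R) -> R).

Lemma upd_same z i x : upd z i x i = x.
Proof. unfold upd; destruct (Defs.eq_dec i i); congruence. Qed.

Lemma upd_other z i j x : j <> i -> upd z i x j = z j.
Proof. unfold upd; destruct (Defs.eq_dec j i); congruence. Qed.

Lemma upd_id z i : upd z i (z i) = z.
Proof.
  apply functional_extensionality; intro j; unfold upd.
  destruct (Defs.eq_dec j i); congruence.
Qed.

Lemma upd_upd z i x y : upd (upd z i x) i y = upd z i y.
Proof.
  apply functional_extensionality; intro j; unfold upd.
  destruct (Defs.eq_dec j i); congruence.
Qed.

Lemma partial_is_derive f z i :
  ex_partial i f z -> is_derive (fun x => f (upd z i x)) (z i) (partial i f z).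
Proof. intro H; apply Derive_correct, H. Qed.

Lemma continuous_coord z i : continuous (fun z' : I -> R => z' i) z.
Proof.
  apply filterlim_locally; intro eps.
  exists eps; intros z' H; exact (H i).
Qed.

(** Continuity of [f] is carried along because the continuity of the partials of products and
    compositions uses it; for an infinite [I] it does not follow from the existence and continuity
    of the partials. *)
Definition C1c A f : Prop := C1_on A f /\ forall z, A z -> continuous f z.

Lemma C1c_C1_on A f : C1c A f -> C1_on A f.
Proof. intros [H _]; exact H. Qed.

Lemma C1_on_intro A f (df : I -> (I -> R) -> R) :
  open A ->
  (forall z, A z -> forall i,
     is_derive (fun x => f (upd z i x)) (z i) (df i z) /\ continuous (df i) z) ->
  C1_on A f.
Proof.
  intros HA H; split; [exact HA |]; intros z i Hz.
  destruct (H z Hz i) as [Hd Hc]; split.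
  - exists (df i z); exact Hd.
  - apply continuous_ext_loc with (df i); [| exact Hc].
    apply filter_imp with A; [| exact (HA z Hz)].
    intros y Hy; symmetry; apply is_derive_unique; exact (proj1 (H y Hy i)).
Qed.

Lemma C1c_intro A f (df : I -> (I -> R) -> R) :
  open A ->
  (forall z, A z -> continuous f z /\ forall i,
     is_derive (fun x => f (upd z i x)) (z i) (df i z) /\ continuous (df i) z) ->
  C1c A f.
Proof.
  intros HA H; split.
  - apply (C1_on_intro A f df HA); intros z Hz; exact (proj2 (H z Hz)).
  - intros z Hz; exact (proj1 (H z Hz)).
Qed.

Lemma C1_on_subset A B f : open B -> subset B A -> C1_on A f -> C1_on B f.
Proof. intros HB HBA [_ H]; split; [exact HB |]; intros z i Hz; apply H, HBA, Hz. Qed.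

Lemma C1c_subset A B f : open B -> subset B A -> C1c A f -> C1c B f.
Proof.
  intros HB HBA [H1 H2]; split.
  - exact (C1_on_subset A B f HB HBA H1).
  - intros z Hz; apply H2, HBA, Hz.
Qed.

Lemma upd_locally A z i : open A -> A z -> locally (z i) (fun x => A (upd z i x)).
Proof.
  intros HA Hz; destruct (HA z Hz) as [eps H]; exists eps; intros x Hx.
  apply H; intro j; unfold upd; destruct (Defs.eq_dec j i) as [-> |].
  - exact Hx.
  - apply ball_center.
Qed.

(** Serves functions glued from local pieces, in particular one obtained by choice on the fibres of
    the invariants. Agreement on an open set is required because [partial] sees neighbouring
    points. *)
Lemma C1_on_local O f :
  (forall y, O y -> exists O' g, O' y /\ subset O' O /\ C1_on O' g /\
     forall y', O' y' -> f y' = g y') ->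
  C1_on O f.
Proof.
  intro H; split.
  - intros y Hy; destruct (H y Hy) as (O' & g & Hy' & Hs & [Ho _] & _).
    apply filter_imp with O'; [exact Hs | exact (Ho y Hy')].
  - intros y i Hy; destruct (H y Hy) as (O' & g & Hy' & Hs & [Ho Hg] & E).
    assert (L : forall y', O' y' ->
              locally (y' i) (fun x => g (upd y' i x) = f (upd y' i x))).
    { intros y' Hy1; apply filter_imp with (fun x => O' (upd y' i x)).
      - intros x Hx; symmetry; exact (E _ Hx).
      - apply upd_locally; assumption. }
    destruct (Hg y i Hy') as [He Hc]; split.
    + apply ex_derive_ext_loc with (2 := He); apply L, Hy'.
    + apply continuous_ext_loc with (2 := Hc).
      apply filter_imp with O'; [| exact (Ho y Hy')].
      intros y' Hy1; apply Derive_ext_loc, L, Hy1.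
Qed.

Lemma C1c_ext A f g : (forall z, A z -> f z = g z) -> C1c A f -> C1c A g.
Proof.
  intros E [H Hc]; split.
  - apply C1_on_local; intros y Hy; exists A, f; repeat split; try assumption.
    + intros x Hx; exact Hx.
    + apply H.
    + apply (proj2 H); assumption.
    + apply (proj2 H); assumption.
    + intros y' Hy'; symmetry; apply E, Hy'.
  - intros z Hz; apply continuous_ext_loc with f.
    + apply filter_imp with A; [exact E | exact (proj1 H z Hz)].
    + apply Hc, Hz.
Qed.

Lemma C1c_const A c : open A -> C1c A (fun _ => c).
Proof.
  intro HA; apply C1c_intro with (fun _ _ => 0); [exact HA |].
  intros z _; split; [apply continuous_const |].
  intro i; split; [apply (is_derive_const c) | apply continuous_const].
Qed.

Lemma C1c_coord A i : open A -> C1c A (fun z => z i).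
Proof.
  intro HA; apply C1c_intro with (fun j _ => if Defs.eq_dec i j then 1 else 0); [exact HA |].
  intros z _; split; [apply continuous_coord |].
  intro j; split; [| apply continuous_const].
  unfold upd; destruct (Defs.eq_dec i j); [apply (is_derive_id (z j)) | apply (is_derive_const (z i))].
Qed.

Lemma C1c_plus A f g : C1c A f -> C1c A g -> C1c A (fun z => f z + g z).
Proof.
  intros [[HA Hf] Cf] [[_ Hg] Cg].
  apply C1c_intro with (fun i z => partial i f z + partial i g z); [exact HA |].
  intros z Hz; split.
  - apply (continuous_plus f g); [apply Cf | apply Cg]; exact Hz.
  - intro i; destruct (Hf z i Hz) as [ef cf], (Hg z i Hz) as [eg cg]; split.
    + apply (is_derive_plus (fun x => f (upd z i x)) (fun x => g (upd z i x)));
        apply partial_is_derive; assumption.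
    + apply (continuous_plus (partial i f) (partial i g)); assumption.
Qed.

Lemma C1c_mult A f g : C1c A f -> C1c A g -> C1c A (fun z => f z * g z).
Proof.
  intros [[HA Hf] Cf] [[_ Hg] Cg].
  apply C1c_intro with (fun i z => partial i f z * g z + f z * partial i g z); [exact HA |].
  intros z Hz; split.
  - apply (continuous_mult f g); [apply Cf | apply Cg]; exact Hz.
  - intro i; destruct (Hf z i Hz) as [ef cf], (Hg z i Hz) as [eg cg]; split.
    + replace (partial i f z * g z + f z * partial i g z)
        with (partial i f z * g (upd z i (z i)) + f (upd z i (z i)) * partial i g z)
        by (rewrite upd_id; reflexivity).
      apply (is_derive_mult (fun x => f (upd z i x)) (fun x => g (upd z i x)));
        try (apply partial_is_derive; assumption).
      intros; apply Rmult_comm.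
    + apply (continuous_plus (fun z => partial i f z * g z) (fun z => f z * partial i g z)).
      * apply (continuous_mult (partial i f) g); [exact cf | apply Cg, Hz].
      * apply (continuous_mult f (partial i g)); [apply Cf, Hz | exact cg].
Qed.

Lemma C1c_comp (phi dphi : R -> R) A f :
  (forall z, A z -> is_derive phi (f z) (dphi (f z)) /\ continuous dphi (f z)) ->
  C1c A f -> C1c A (fun z => phi (f z)).
Proof.
  intros Hphi [[HA Hf] Cf].
  apply C1c_intro with (fun i z => partial i f z * dphi (f z)); [exact HA |].
  intros z Hz; destruct (Hphi z Hz) as [Hd Hc]; split.
  - apply (continuous_comp f phi); [apply Cf, Hz |].
    apply (ex_derive_continuous (K := R_AbsRing) (V := R_NormedModule) phi).
    exists (dphi (f z)); exact Hd.
  - intro i; destruct (Hf z i Hz) as [ef cf]; split.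
    + apply (is_derive_comp phi (fun x => f (upd z i x))).
      * rewrite upd_id; exact Hd.
      * apply partial_is_derive, ef.
    + apply (continuous_mult (partial i f) (fun z => dphi (f z))); [exact cf |].
      apply (continuous_comp f dphi); [apply Cf, Hz | exact Hc].
Qed.

Lemma C1c_opp A f : C1c A f -> C1c A (fun z => - f z).
Proof.
  intro H; apply C1c_ext with (fun z => -1 * f z); [intros; ring |].
  apply C1c_mult; [apply C1c_const, (proj1 (proj1 H)) | exact H].
Qed.

Lemma C1c_minus A f g : C1c A f -> C1c A g -> C1c A (fun z => f z - g z).
Proof. intros Hf Hg; apply (C1c_plus A f (fun z => - g z) Hf), C1c_opp, Hg. Qed.

Lemma C1c_pow A f k : C1c A f -> C1c A (fun z => f z ^ k).
Proof.
  intro H; induction k as [| k IH]; simpl.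
  - apply C1c_const, (proj1 (proj1 H)).
  - apply (C1c_mult A f (fun z => f z ^ k) H IH).
Qed.

Lemma C1c_inv A f : (forall z, A z -> f z <> 0) -> C1c A f -> C1c A (fun z => / f z).
Proof.
  intros H0 H; apply (C1c_comp Rinv (fun x => - / x ^ 2)); [| exact H].
  intros z Hz; specialize (H0 z Hz); split.
  - auto_derive; [exact H0 | field; exact H0].
  - apply (ex_derive_continuous (K := R_AbsRing) (V := R_NormedModule)).
    auto_derive. nra.
Qed.

Lemma C1c_div A f g :
  (forall z, A z -> g z <> 0) -> C1c A f -> C1c A g -> C1c A (fun z => f z / g z).
Proof. intros H0 Hf Hg; apply (C1c_mult A f (fun z => / g z) Hf), C1c_inv; assumption. Qed.

Lemma C1c_sqrt A f : (forall z, A z -> 0 < f z) -> C1c A f -> C1c A (fun z => sqrt (f z)).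
Proof.
  intros H0 H; apply (C1c_comp sqrt (fun x => / (2 * sqrt x))); [| exact H].
  intros z Hz; specialize (H0 z Hz); pose proof (sqrt_lt_R0 _ H0); split.
  - auto_derive; [exact H0 | field; lra].
  - apply (ex_derive_continuous (K := R_AbsRing) (V := R_NormedModule)).
    auto_derive; split; [exact H0 | split; [lra | exact Logic.I]].
Qed.

Lemma open_positive A f :
  open A -> (forall z, A z -> continuous f z) -> open (fun z => A z /\ 0 < f z).
Proof.
  intros HA Hf z [Hz H0]; apply filter_and; [exact (HA z Hz) |].
  exact (Hf z Hz _ (open_gt 0 (f z) H0)).
Qed.

End C1Functions.

(** * Jets *)

(* [jet] hides the function type from which the uniform structure is inferred. *)
Local Notation open_jets := (@open (fct_UniformSpace coord R_UniformSpace)).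
Local Notation near_jet := (@locally (fct_UniformSpace coord R_UniformSpace)).

Definition coords : list coord := c_t :: c_r :: c_U :: c_rho :: c_S :: c_Ur :: c_rhor :: c_Sr :: nil.

Definition jet_of (t r U rho S Ur rhor Sr : R) : jet := fun j =>
  match j with
  | c_t => t | c_r => r | c_U => U | c_rho => rho | c_S => S
  | c_Ur => Ur | c_rhor => rhor | c_Sr => Sr
  end.

Definition directional (v : jet) (f : jet -> R) (z : jet) : R :=
  fold_right (fun i acc => v i * partial i f z + acc) 0 coords.

(** Finiteness of [coord] enters here: a filter is closed under finite intersections only. *)
Lemma filter_coords {T : Type} (F : (T -> Prop) -> Prop) {FF : Filter F}
  (P : coord -> T -> Prop) :
  (forall j, F (P j)) -> F (fun x => forall j, P j x).
Proof.
  intro H.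
  apply filter_imp with (fun x => P c_t x /\ P c_r x /\ P c_U x /\ P c_rho x /\ P c_S x
    /\ P c_Ur x /\ P c_rhor x /\ P c_Sr x).
  - intros x Hx j; destruct j; tauto.
  - repeat (apply filter_and; [apply H |]); apply H.
Qed.

Lemma continuous_to_jet {T : UniformSpace} (G : T -> jet) (x : T) :
  (forall j, continuous (fun y => G y j) x) ->
  filterlim G (locally x) (near_jet (G x)).
Proof.
  intro H; apply filterlim_locally; intro eps.
  apply (filter_coords _ (fun j y => ball (G x j) eps (G y j))).
  intro j; exact (proj1 (filterlim_locally _ _) (H j) eps).
Qed.

(** A chain rule that tolerates a [k] which is stationary or returns to its value at [s]: the
    increment of [g] is a multiple of that of [k], with a factor [q] tending to [l], so no division
    by the increment of [k] occurs. *)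
Lemma is_derive_caratheodory (g k : R -> R) (s k' l : R) :
  (forall eps : posreal, locally s (fun x =>
     exists q, Rabs (q - l) < eps /\ g x - g s = q * (k x - k s))) ->
  is_derive k s k' -> is_derive g s (l * k').
Proof.
  intros H Hk; apply is_derive_Reals; apply is_derive_Reals in Hk; intros eps Heps.
  (* The error is [(q - l) * K + l * (K - k')]. Each summand gets half of [eps]; the bound 1 in [e2]
     ensures that [K] is at most [Rabs k' + 1] in absolute value. *)
  set (e1 := eps / (2 * (Rabs k' + 1))).
  set (e2 := Rmin 1 (eps / (2 * (Rabs l + 1)))).
  assert (Hk0 := Rabs_pos k'); assert (Hl0 := Rabs_pos l).
  assert (He1 : 0 < e1) by (apply Rdiv_lt_0_compat; lra).
  assert (He2 : 0 < e2) by (apply Rmin_pos; [lra | apply Rdiv_lt_0_compat; lra]).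
  destruct (H (mkposreal e1 He1)) as [d1 H1]; destruct (Hk e2 He2) as [d2 H2].
  assert (Hd : 0 < Rmin d1 d2) by (apply Rmin_pos; apply cond_pos).
  exists (mkposreal _ Hd); simpl; intros h Hh0 Hh.
  destruct (H1 (s + h)) as [q [Hq E]].
  { unfold ball; simpl; unfold AbsRing_ball, abs, minus, plus, opp; simpl.
    replace (s + h + - s) with h by ring.
    apply Rlt_le_trans with (1 := Hh), Rmin_l. }
  assert (Hh2 := H2 h Hh0 (Rlt_le_trans _ _ _ Hh (Rmin_r _ _))); simpl in Hq.
  rewrite E; set (K := (k (s + h) - k s) / h) in *.
  replace (q * (k (s + h) - k s) / h - l * k') with ((q - l) * K + l * (K - k'))
    by (unfold K; field; exact Hh0).
  assert (HK : Rabs K <= Rabs k' + 1).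
  { replace K with (k' + (K - k')) by ring; eapply Rle_trans; [apply Rabs_triang |].
    assert (e2 <= 1) by apply Rmin_l; lra. }
  assert (Hl : Rabs l * e2 <= eps / 2).
  { apply Rle_trans with (Rabs l * (eps / (2 * (Rabs l + 1)))).
    - apply Rmult_le_compat_l; [exact Hl0 | apply Rmin_r].
    - replace (eps / 2) with ((Rabs l + 1) * (eps / (2 * (Rabs l + 1)))) by (field; lra).
      apply Rmult_le_compat_r; [| lra].
      apply Rlt_le, Rdiv_lt_0_compat; lra. }
  assert (Hm : Rabs (q - l) * Rabs K < e1 * (Rabs k' + 1)).
  { assert (0 <= Rabs (q - l)) by apply Rabs_pos. assert (0 <= Rabs K) by apply Rabs_pos.
    nra. }
  assert (He : e1 * (Rabs k' + 1) = eps / 2) by (unfold e1; field; lra).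
  assert (Hn : Rabs l * Rabs (K - k') <= Rabs l * e2).
  { apply Rmult_le_compat_l; lra. }
  eapply Rle_lt_trans; [apply Rabs_triang |]; rewrite !Rabs_mult; lra.
Qed.

(** By the mean value theorem in coordinate [i] alone, the difference is the increment of [G x i]
    times [partial i f] at an intermediate point. That point tends to [G s], so continuity of the
    partial gives the factor needed by [is_derive_caratheodory]. *)
Lemma is_derive_coord (Om : jet -> Prop) (f : jet -> R) (G : R -> jet) (s : R) (v : jet) (i : coord) :
  C1_on Om f -> Om (G s) -> (forall j, is_derive (fun x => G x j) s (v j)) ->
  is_derive (fun x => f (G x) - f (upd (G x) i (G s i))) s (v i * partial i f (G s)).
Proof.
  intros [HO Hf] Hs HG; rewrite Rmult_comm.
  apply is_derive_caratheodory with (fun x => G x i); [| apply HG].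
  intro eps; destruct (Hf _ i Hs) as [_ Hc].
  destruct (filter_and _ _ (HO _ Hs) (proj1 (filterlim_locally _ _) Hc eps)) as [d Hd].
  assert (L : locally s (fun x => forall j, ball (G s j) d (G x j))).
  { apply (filter_coords (locally s) (fun j x => ball (G s j) d (G x j))).
    intro j; refine (proj1 (filterlim_locally _ _) _ d).
    apply (ex_derive_continuous (K := R_AbsRing) (V := R_NormedModule) (fun x => G x j)).
    exists (v j); apply HG. }
  revert L; apply filter_imp; intros x Hx.
  assert (B : forall y, Rmin (G s i) (G x i) <= y <= Rmax (G s i) (G x i) ->
            ball (M := fct_UniformSpace coord R_UniformSpace) (G s) d (upd (G x) i y)).
  { intros y Hy j; unfold upd; destruct (Defs.eq_dec j i) as [-> |]; [| apply Hx].
    specialize (Hx i); revert Hx; unfold ball; simpl; unfold AbsRing_ball, abs, minus, plus, opp; simpl.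
    intro Hx; apply Rle_lt_trans with (2 := Hx).
    revert Hy; unfold Rmin, Rmax; destruct (Rle_dec (G s i) (G x i));
      intros Hy; unfold Rabs; destruct (Rcase_abs _), (Rcase_abs _); lra. }
  assert (Dv : forall y, Rmin (G s i) (G x i) <= y <= Rmax (G s i) (G x i) ->
            is_derive (fun y => f (upd (G x) i y)) y (partial i f (upd (G x) i y))).
  { intros y Hy; destruct (Hf (upd (G x) i y) i (proj1 (Hd _ (B y Hy)))) as [He _].
    apply partial_is_derive in He; rewrite upd_same in He.
    apply is_derive_ext with (2 := He); intro u; rewrite upd_upd; reflexivity. }
  destruct (MVT_gen (fun y => f (upd (G x) i y)) (G s i) (G x i)
              (fun y => partial i f (upd (G x) i y))) as [c [Hcc E]].
  - intros y Hy; apply Dv; lra.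
  - intros y Hy; apply continuity_pt_filterlim.
    apply (ex_derive_continuous (K := R_AbsRing) (V := R_NormedModule)).
    eexists; apply Dv, Hy.
  - exists (partial i f (upd (G x) i c)); split.
    + exact (proj2 (Hd _ (B c Hcc))).
    + rewrite <- E; rewrite !upd_id; ring.
Qed.

(** The coordinates are frozen one at a time at their value at [s]; each freezing contributes one
    summand, and a curve with all coordinates frozen is constant. *)
Lemma is_derive_chain_list (Om : jet -> Prop) (f : jet -> R) (s : R) (l : list coord) :
  C1_on Om f -> NoDup l ->
  forall (G : R -> jet) (v : jet),
    Om (G s) -> (forall j, is_derive (fun x => G x j) s (v j)) ->
    (forall j, ~ In j l -> forall x, G x j = G s j) ->
    is_derive (fun x => f (G x)) s
      (fold_right (fun i acc => v i * partial i f (G s) + acc) 0 l).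
Proof.
  intros Hf; induction l as [| i l IH]; intros Hl G v Hs HG Hc.
  - apply is_derive_ext with (fun _ => f (G s)).
    + intro x; f_equal; apply functional_extensionality; intro j.
      symmetry; apply Hc; intros [].
    + apply (is_derive_const (f (G s))).
  - inversion Hl as [| ? ? Hi Hl']; subst; simpl.
    set (G' := fun x => upd (G x) i (G s i)).
    assert (E : G' s = G s) by apply upd_id.
    apply is_derive_ext with (fun x => (f (G x) - f (G' x)) + f (G' x)); [intros x; simpl; ring |].
    apply (is_derive_plus (fun x => f (G x) - f (G' x)) (fun x => f (G' x))).
    + apply is_derive_coord with Om; assumption.
    (* The curve [G'] has velocity [v] with entry [i] set to 0. As [i] does not occur in [l], the
       sum over [l] is unaffected. *)
    + replace (fold_right _ 0 l) with
        (fold_right (fun j acc => upd v i 0 j * partial j f (G' s) + acc) 0 l).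
      * apply IH; [exact Hl' | rewrite E; exact Hs | |].
        -- intro j; unfold G', upd; destruct (Defs.eq_dec j i).
           ++ apply (is_derive_const (G s i)).
           ++ apply HG.
        -- intros j Hj x; unfold G', upd; destruct (Defs.eq_dec j i) as [| Hn]; [reflexivity |].
           apply Hc; intros [-> |]; [apply Hn; reflexivity | contradiction].
      * rewrite E; clear - Hi; induction l as [| j l IH]; [reflexivity |]; simpl.
        rewrite IH by (intro; apply Hi; right; assumption).
        rewrite upd_other; [reflexivity |]; intros ->; apply Hi; left; reflexivity.
Qed.

Lemma is_derive_chain (Om : jet -> Prop) (f : jet -> R) (G : R -> jet) (s : R) (v : jet) :
  C1_on Om f -> Om (G s) -> (forall j, is_derive (fun x => G x j) s (v j)) ->
  is_derive (fun x => f (G x)) s (directional v f (G s)).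
Proof.
  intros Hf Hs HG; apply is_derive_chain_list with Om; try assumption.
  - repeat constructor; simpl; intuition discriminate.
  - intros j Hj; exfalso; apply Hj; destruct j; simpl; tauto.
Qed.

(** The partials of the composite are directional derivatives of [J] along the partials of [G],
    finite sums whose continuity is checked term by term. *)
Lemma C1_on_comp {I : Type} {dec : EqDec I} (Om : jet -> Prop) (J : jet -> R)
  (O : (I -> R) -> Prop) (G : (I -> R) -> jet) :
  C1_on Om J -> open O -> (forall j, C1c O (fun y => G y j)) ->
  (forall y, O y -> Om (G y)) -> C1_on O (fun y => J (G y)).
Proof.
  intros HJ HO HG Hsub.
  apply C1_on_intro with
    (fun i y => directional (fun j => partial i (fun y => G y j) y) J (G y)); [exact HO |].
  intros y Hy i; split.
  - replace (G y) with (G (upd y i (y i))) by (rewrite upd_id; reflexivity).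
    apply (is_derive_chain Om J (fun x => G (upd y i x))); [exact HJ | |].
    + rewrite upd_id; apply Hsub, Hy.
    + intro j; apply (partial_is_derive (fun y => G y j)).
      apply (proj2 (proj1 (HG j))), Hy.
  - assert (T : forall j, continuous
        (fun y => partial i (fun y => G y j) y * partial j J (G y)) y).
    { intro j; apply (continuous_mult (partial i (fun y => G y j)) (fun y => partial j J (G y))).
      - apply (proj2 (proj1 (HG j))), Hy.
      - eapply filterlim_comp.
        + apply continuous_to_jet; intro k; apply (proj2 (HG k)), Hy.
        + apply (proj2 HJ), Hsub, Hy. }
    unfold directional; induction coords as [| j l IH]; simpl.
    + apply continuous_const.
    + apply (continuous_plus
        (fun y => partial i (fun y => G y j) y * partial j J (G y))
        (fun y => fold_right (fun j acc => partial i (fun y => G y j) y * partial j J (G y) + acc) 0 l)).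
      * apply T.
      * exact IH.
Qed.

(** * Functional dependence by straightening *)

Section Straightening.
Context {I : Type} {dec : EqDec I}.

(** In the coordinates [q = Q z] the invariants are some of the coordinates:
    [lab j = Some i] says that coordinate [j] is invariant [i]. *)
Variables (Om : jet -> Prop) (J : jet -> R) (W : jet -> Prop) (Psi Q : jet -> jet)
  (pos : I -> coord) (lab : coord -> option I) (inv : jet -> I -> R).

Hypothesis HJ : C1_on Om J.
Hypothesis HW : open_jets W.
Hypothesis HPsi : forall j, C1c W (fun q => Psi q j).
Hypothesis Hlab : forall i, lab (pos i) = Some i.
Hypothesis Hpos : forall i j, lab j = Some i -> j = pos i.
Hypothesis Hinv : forall z i, inv z i = Q z (pos i).
Hypothesis HQ : forall z, Om z ->
  W (Q z) /\ Psi (Q z) = z /\ forall j, continuous (fun z' : coord -> R => Q z' j) z.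
Hypothesis HQP : forall q, W q -> Om (Psi q) -> forall i, Q (Psi q) (pos i) = q (pos i).
Hypothesis Hfree : forall q j, W q -> Om (Psi q) -> lab j = None ->
  is_derive (fun x => J (Psi (upd q j x))) (q j) 0.

Let W' (q : jet) : Prop := W q /\ Om (Psi q).

Lemma straightening_open (V : jet -> Prop) :
  open_jets V ->
  open_jets (fun q => W q /\ V (Psi q)).
Proof using HW HPsi.
  intros HV q [Hq HVq]; apply filter_and; [exact (HW q Hq) |].
  refine (continuous_to_jet (T := fct_UniformSpace coord R_UniformSpace) Psi q _ V (HV _ HVq)).
  intro j; apply (proj2 (HPsi j)), Hq.
Qed.

Definition segment (q q' : jet) (s : R) : jet := fun j => q j + s * (q' j - q j).

(** The velocity of the segment vanishes in the labelled coordinates, and the partials of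
    [J (Psi q)] vanish in the others, so every term of the chain rule is 0. *)
Lemma constant_on_segment (q q' : jet) :
  (forall j, lab j <> None -> q j = q' j) ->
  (forall s, 0 <= s <= 1 -> W (segment q q' s) /\ Om (Psi (segment q q' s))) ->
  J (Psi q) = J (Psi q').
Proof using HW HPsi HJ Hfree.
  intros Hq Hs.
  assert (HK : C1_on W' (fun q => J (Psi q))).
  { apply C1_on_comp with Om.
    - exact HJ.
    - apply straightening_open, (proj1 HJ).
    - intro j; apply C1c_subset with W; [apply straightening_open, (proj1 HJ) | | apply HPsi].
      intros x Hx; exact (proj1 Hx).
    - intros y Hy; exact (proj2 Hy). }
  assert (E : J (Psi (segment q q' 0)) = J (Psi (segment q q' 1))).
  { apply (eq_is_derive (fun s => J (Psi (segment q q' s))) 0 1); [| lra].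
    intros s H; destruct (Hs s H) as [H1 H2].
    change (is_derive (fun s => J (Psi (segment q q' s))) s 0).
    replace 0 with (directional (fun j => q' j - q j) (fun q => J (Psi q)) (segment q q' s)).
    - apply (is_derive_chain W' (fun q => J (Psi q)) (segment q q')).
      + exact HK.
      + split; assumption.
      + intro j; unfold segment; auto_derive; [exact Logic.I | ring].
    - unfold directional; induction coords as [| j l IH]; [reflexivity |]; simpl; rewrite IH.
      destruct (lab j) as [i |] eqn:L.
      + rewrite <- (Hq j) by (rewrite L; discriminate). ring.
      + replace (partial j (fun q => J (Psi q)) (segment q q' s)) with 0.
        * ring.
        * symmetry; apply is_derive_unique, Hfree; assumption. }
  replace (segment q q' 0) with q in E
    by (apply functional_extensionality; intro j; unfold segment; ring).
  replace (segment q q' 1) with q' in E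
    by (apply functional_extensionality; intro j; unfold segment; ring).
  exact E.
Qed.

(** The fibre condition makes [F] well defined on the image of [inv]. Its smoothness comes from
    local sections of [inv]: near each value, [F] is [J] composed with such a section. *)
Lemma function_of_fibers (V : jet -> Prop) :
  open_jets V -> subset V Om ->
  (forall z z', V z -> V z' -> inv z = inv z' -> J z = J z') ->
  function_of V inv J.
Proof using All.
  intros HV HVO Hfib.
  set (O := fun y : I -> R => exists z, V z /\ inv z = y).
  (* The value 0 is a default off the image of [inv]; the domain [O] is exactly that image. *)
  destruct (choice (fun y v => forall z, V z -> inv z = y -> J z = v)) as [F HF].
  { intro y; destruct (classic (O y)) as [[z [Hz E]] | N].
    - exists (J z); intros z' Hz' E'; apply Hfib; congruence.
    - exists 0; intros z Hz E; exfalso; apply N; exists z; tauto. }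
  exists O, F; split.
  2:{ intros z Hz; split; [exists z; tauto | apply HF; auto]. }
  apply C1_on_local; intros y0 [z0 [Hz0 E0]].
  destruct (HQ z0 (HVO _ Hz0)) as [HWz0 [HPQ _]].
  (* The local section is [Psi (emb y)]: the values [y] fill the labelled coordinates while the free
     ones stay at those of [Q z0]. *)
  set (emb := fun (y : I -> R) (j : coord) =>
                match lab j with Some i => y i | None => Q z0 j end).
  assert (Hemb : emb y0 = Q z0).
  { apply functional_extensionality; intro j; unfold emb.
    destruct (lab j) as [i |] eqn:L; [| reflexivity].
    rewrite (Hpos i j L), <- E0; apply Hinv. }
  set (O' := fun y => W (emb y) /\ V (Psi (emb y))).
  assert (Cemb : forall y j, continuous (fun y : I -> R => emb y j) y).
  { intros y j; unfold emb; destruct (lab j).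
    - apply continuous_coord.
    - apply continuous_const. }
  assert (HO' : open (T := fct_UniformSpace I R_UniformSpace) O').
  { intros y Hy.
    refine (continuous_to_jet (T := fct_UniformSpace I R_UniformSpace) emb y (Cemb y)
              (fun q => W q /\ V (Psi q)) _).
    apply (straightening_open V HV (emb y)), Hy. }
  assert (HiP : forall y, O' y -> inv (Psi (emb y)) = y).
  { intros y [H1 H2]; apply functional_extensionality; intro i.
    rewrite Hinv, HQP; [| exact H1 | apply HVO, H2].
    unfold emb; rewrite Hlab; reflexivity. }
  exists O', (fun y => J (Psi (emb y))); split; [| split; [| split]].
  - unfold O'; rewrite Hemb, HPQ; split; assumption.
  - intros y Hy; exists (Psi (emb y)); split; [apply Hy | apply HiP, Hy].
  - apply (C1_on_comp W' (fun q => J (Psi q)) O' emb).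
    + apply C1_on_comp with Om; [exact HJ | apply straightening_open, (proj1 HJ) | |].
      * intro j; apply C1c_subset with W; [apply straightening_open, (proj1 HJ) | | apply HPsi].
        intros x Hx; exact (proj1 Hx).
      * intros q Hq; exact (proj2 Hq).
    + exact HO'.
    + intro j; unfold emb; destruct (lab j); [apply C1c_coord | apply C1c_const]; exact HO'.
    + intros y [H1 H2]; split; [exact H1 | apply HVO, H2].
  - intros y Hy; symmetry; apply HF; [apply Hy | apply HiP, Hy].
Qed.

Lemma fiber_coordinates (z z' : jet) :
  inv z = inv z' -> forall j, lab j <> None -> Q z j = Q z' j.
Proof using Hinv Hpos.
  intros E j Hj; destruct (lab j) as [i |] eqn:L; [| congruence].
  rewrite (Hpos i j L), <- !Hinv, E; reflexivity.
Qed.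

Lemma function_of_convex_fibers :
  (forall z z', Om z -> Om z' -> inv z = inv z' -> forall s, 0 <= s <= 1 ->
     W (segment (Q z) (Q z') s) /\ Om (Psi (segment (Q z) (Q z') s))) ->
  function_of Om inv J.
Proof using All.
  intro H; apply function_of_fibers; [apply HJ | intros z Hz; exact Hz |].
  intros z z' Hz Hz' E.
  rewrite <- (proj1 (proj2 (HQ z Hz))), <- (proj1 (proj2 (HQ z' Hz'))).
  apply constant_on_segment; [apply fiber_coordinates, E | apply H; assumption].
Qed.

Lemma locally_function_of_straightened : locally_function_of Om inv J.
Proof using All.
  intros z0 Hz0; destruct (HQ z0 Hz0) as [HWz [HPQ HC]].
  destruct (straightening_open Om (proj1 HJ) (Q z0)) as [d Hd].
  { rewrite HPQ; split; assumption. }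
  set (P := fun z => Om z /\
    ball (M := fct_UniformSpace coord R_UniformSpace) (Q z0) d (Q z)).
  (* Taking the interior of [P] gives openness by construction; [z0] lies in it by continuity of [Q]
     at [z0]. *)
  set (V := fun z => near_jet z P).
  assert (HVP : subset V P) by (intros z Hz; exact (locally_singleton z P Hz)).
  exists V; split; [| split; [| split]].
  - intros z Hz; exact (locally_locally z P Hz).
  - apply filter_and; [exact (proj1 HJ z0 Hz0) |].
    refine (continuous_to_jet (T := fct_UniformSpace coord R_UniformSpace) Q z0 HC _ _).
    exists d; intros y Hy; exact Hy.
  - intros z Hz; exact (proj1 (HVP z Hz)).
  - apply function_of_fibers.
    + intros z Hz; exact (locally_locally z P Hz).
    + intros z Hz; exact (proj1 (HVP z Hz)).
    + intros z z' Hz Hz' E; destruct (HVP z Hz) as [Hz1 Hz2], (HVP z' Hz') as [Hz1' Hz2'].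
      rewrite <- (proj1 (proj2 (HQ z Hz1))), <- (proj1 (proj2 (HQ z' Hz1'))).
      apply constant_on_segment; [apply fiber_coordinates, E |].
      (* A ball of the sup distance is convex, coordinate by coordinate. The case [s = 0] is
         separated so that, for [s > 0], the strict bound at the second endpoint keeps the
         inequality strict. *)
      intros s Hs; apply Hd; intro j; specialize (Hz2 j); specialize (Hz2' j).
      revert Hz2 Hz2'; unfold ball; simpl; unfold AbsRing_ball, abs, minus, plus, opp; simpl.
      unfold segment; intros H1 H2.
      apply Rabs_def2 in H1; apply Rabs_def2 in H2.
      destruct (Rle_lt_or_eq_dec 0 s (proj1 Hs)) as [Hs0 | <-];
        [| apply Rabs_def1; lra].
      apply Rabs_def1; nra.
Qed.

End Straightening.

Lemma locally_function_of_mono {I : Type} {dec : EqDec I} (Om : jet -> Prop)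
  (inv : jet -> I -> R) (J : jet -> R) :
  (forall z, Om z -> exists Om', Om' z /\ subset Om' Om /\ locally_function_of Om' inv J) ->
  locally_function_of Om inv J.
Proof.
  intros H z Hz; destruct (H z Hz) as (Om' & Hz' & Hs & Hl).
  destruct (Hl z Hz') as (V & HV & HVz & HVs & HF).
  exists V; repeat split; try assumption; intros x Hx; apply Hs, HVs, Hx.
Qed.

(** * The determining equations of a scalar invariant *)

Lemma zero_derivative_constant (f : R -> R) (x0 d : R) :
  (forall x, Rabs (x - x0) < d -> is_derive f x 0) ->
  forall x, Rabs (x - x0) < d -> f x = f x0.
Proof.
  intros H x Hx.
  destruct (MVT_gen f x0 x (fun _ => 0)) as [c [_ E]]; [| | lra].
  - intros y Hy; apply H; revert Hy Hx; unfold Rmin, Rmax, Rabs.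
    destruct (Rle_dec x0 x), (Rcase_abs (y - x0)), (Rcase_abs (x - x0)); lra.
  - intros y Hy; apply continuity_pt_filterlim.
    apply (ex_derive_continuous (K := R_AbsRing) (V := R_NormedModule)).
    exists 0; apply H; revert Hy Hx; unfold Rmin, Rmax, Rabs.
    destruct (Rle_dec x0 x), (Rcase_abs (y - x0)), (Rcase_abs (x - x0)); lra.
Qed.

(** Replaces differentiation of an equation in the variable [i]: on a small box [f] does not depend
    on coordinate [i], hence neither do its other partials, and an equation between them may be
    compared at two values of that coordinate. *)
Lemma partial_shift {I : Type} {dec : EqDec I} (A : (I -> R) -> Prop) (f : (I -> R) -> R)
  (z : I -> R) (i : I) :
  C1_on A f -> (forall y, A y -> partial i f y = 0) -> A z ->
  locally (z i) (fun x => A (upd z i x) /\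
    forall j, j <> i -> partial j f (upd z i x) = partial j f z).
Proof.
  intros [HA Hf] H0 Hz; destruct (HA z Hz) as [d Hd].
  exists d; intros x Hx; split.
  { apply Hd; intro j; unfold upd; destruct (Defs.eq_dec j i) as [-> |]; [exact Hx | apply ball_center]. }
  intros j Hj; unfold partial; rewrite (upd_other z i j) by exact Hj.
  apply Derive_ext_loc; exists d; intros y Hy.
  assert (E : forall u, upd (upd z i u) j y = upd (upd z j y) i u).
  { intro u; apply functional_extensionality; intro k; unfold upd.
    destruct (Defs.eq_dec k j), (Defs.eq_dec k i); congruence. }
  rewrite E; rewrite <- (upd_id (upd z j y) i) at 2.
  rewrite (upd_other z j i) by congruence.
  apply (zero_derivative_constant (fun u => f (upd (upd z j y) i u)) (z i) d); [| exact Hx].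
  intros u Hu; assert (Au : A (upd (upd z j y) i u)).
  { apply Hd; intro k; unfold upd; destruct (Defs.eq_dec k i) as [-> |]; [exact Hu |].
    destruct (Defs.eq_dec k j) as [-> |]; [exact Hy | apply ball_center]. }
  rewrite <- (H0 _ Au); destruct (Hf _ i Au) as [He _].
  apply partial_is_derive in He; rewrite upd_same in He.
  apply is_derive_ext with (2 := He); intro v; rewrite upd_upd; reflexivity.
Qed.

Definition p_rho (p : R -> R -> R) (z : jet) : R := Derive (fun rho => p rho (z c_S)) (z c_rho).
Definition p_S (p : R -> R -> R) (z : jet) : R := Derive (fun S => p (z c_rho) S) (z c_S).

(** The velocity of the jet of a solution along the flow lines. *)
Definition flow_velocity (n : nat) (p : R -> R -> R) (z : jet) (Urr rhorr Srr : R) : jet :=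
  jet_of 1 (z c_U)
    (- (p_S p z * z c_Sr + p_rho p z * z c_rhor) / z c_rho)
    (- (z c_Ur * z c_rho + (INR n - 1) / z c_r * z c_U * z c_rho))
    0
    (D_r (euler_U p) z 0 0 0 - p_rho p z / z c_rho * rhorr - p_S p z / z c_rho * Srr)
    (D_r (euler_rho n) z 0 0 0 - z c_rho * Urr)
    (- (z c_Ur * z c_Sr)).

(** The second-order variables enter the total derivatives linearly. The parts of the differentiated
    Euler equations that come from advection, [U] times a second-order variable, cancel against
    [U D_r J]; only the pressure and compression terms keep such variables. *)
Lemma material_derivative_directional (n : nat) (p : R -> R -> R) (J : jet -> R)
  (z : jet) (Urr rhorr Srr : R) :
  0 < z c_r -> 0 < z c_rho ->
  material_derivative n p J z Urr rhorr Srr =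
  directional (flow_velocity n p z Urr rhorr Srr) J z.
Proof.
  intros Hr Hrho.
  assert (EU : D_r (euler_U p) z Urr rhorr Srr = D_r (euler_U p) z 0 0 0
                 - z c_U * Urr - p_rho p z / z c_rho * rhorr - p_S p z / z c_rho * Srr).
  (* Only the partials in [Ur], [rhor], [Sr] are evaluated. The remaining ones, with the second
     derivatives of [p], are the same on both sides. *)
  { unfold D_r.
    replace (partial c_Ur (euler_U p) z) with (- z c_U).
    2:{ symmetry; apply is_derive_unique; unfold euler_U, upd; simpl.
        auto_derive; [exact Logic.I | ring]. }
    replace (partial c_rhor (euler_U p) z) with (- p_rho p z / z c_rho).
    2:{ symmetry; apply is_derive_unique; unfold euler_U, upd, p_rho; simpl.
        auto_derive; [exact Logic.I | field; lra]. }
    replace (partial c_Sr (euler_U p) z) with (- p_S p z / z c_rho).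
    2:{ symmetry; apply is_derive_unique; unfold euler_U, upd, p_S; simpl.
        auto_derive; [exact Logic.I | field; lra]. }
    field; lra. }
  assert (Erho : D_r (euler_rho n) z Urr rhorr Srr = D_r (euler_rho n) z 0 0 0
                 - z c_rho * Urr - z c_U * rhorr).
  { unfold D_r.
    replace (partial c_Ur (euler_rho n) z) with (- z c_rho).
    2:{ symmetry; apply is_derive_unique; unfold euler_rho, upd; simpl.
        auto_derive; [exact Logic.I | ring]. }
    replace (partial c_rhor (euler_rho n) z) with (- z c_U).
    2:{ symmetry; apply is_derive_unique; unfold euler_rho, upd; simpl.
        auto_derive; [exact Logic.I | ring]. }
    replace (partial c_Sr (euler_rho n) z) with 0.
    2:{ symmetry; apply is_derive_unique; unfold euler_rho, upd; simpl.
        auto_derive; [exact Logic.I | ring]. }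
    ring. }
  assert (ES : D_r euler_S z Urr rhorr Srr = - (z c_Ur * z c_Sr) - z c_U * Srr).
  { unfold D_r, partial, euler_S, upd; simpl; rewrite !Derive_const.
    replace (Derive (fun x => - (x * z c_Sr)) (z c_U)) with (- z c_Sr).
    2:{ symmetry; apply is_derive_unique; auto_derive; [exact Logic.I | ring]. }
    replace (Derive (fun x => - (z c_U * x)) (z c_Sr)) with (- z c_U).
    2:{ symmetry; apply is_derive_unique; auto_derive; [exact Logic.I | ring]. }
    ring. }
  unfold material_derivative; rewrite EU, Erho, ES.
  unfold D_t, D_r at 3, directional, flow_velocity, euler_U at 1, euler_rho at 1, euler_S, p_S, p_rho; simpl.
  field; split; lra.
Qed.

(** * Splitting the determining equations *)

Section Determining.
Variables (n : nat) (D : R * R -> Prop) (p : R -> R -> R).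
Hypotheses (hD : eos_domain D) (hp : C2_eos D p)
  (hunif : uniform_type D p) (hnonconst : ~ constant_eos D p).

Lemma C2_eos_is_derive (rho S : R) : D (rho, S) ->
  is_derive (fun x => p x S) rho (Derive (fun x => p x S) rho) /\
  is_derive (fun x => p rho x) S (Derive (fun x => p rho x) S).
Proof using hp.
  intro H; destruct (hp rho S H) as (_ & H1 & H2 & _); split; apply Derive_correct; assumption.
Qed.

Lemma box_around (P : R * R -> Prop) (rho S : R) :
  D (rho, S) -> locally (rho, S) P ->
  exists d : posreal, forall x y, Rabs (x - rho) < d -> Rabs (y - S) < d -> D (x, y) /\ P (x, y).
Proof using hD.
  intros H HP; destruct (filter_and _ _ (proj1 hD _ H) HP) as [d Hd].
  exists d; intros x y Hx Hy; apply Hd; split; assumption.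
Qed.

Lemma open_box (rho S d : R) :
  open (fun q : R * R => Rabs (fst q - rho) < d /\ Rabs (snd q - S) < d).
Proof.
  apply open_and; (apply open_comp with (D := fun x => Rabs x < d);
    [| apply open_comp with (D := fun x => x < d); [| apply open_lt];
       intros x _; apply continuous_Rabs]).
  - intros x _; apply (continuous_minus (fun q : R * R => fst q) (fun _ => rho));
      [apply continuous_fst | apply continuous_const].
  - intros x _; apply (continuous_minus (fun q : R * R => snd q) (fun _ => S));
      [apply continuous_snd | apply continuous_const].
Qed.

(** A gradient vanishing near a point makes [p] constant on a box, any two points of which are
    joined by moves parallel to the axes, and [uniform_type] spreads constancy from the box to
    [D]. *)
Lemma not_locally_constant (rho S : R) : D (rho, S) ->
  ~ locally (rho, S) (fun q => Derive (fun x => p x (snd q)) (fst q) = 0 /\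
                               Derive (fun x => p (fst q) x) (snd q) = 0).
Proof using hD hp hunif hnonconst.
  intros H HP; destruct (box_around _ rho S H HP) as [d Hd]; simpl in Hd.
  assert (Hd0 := cond_pos d).
  assert (Z : forall c : R, Rabs (c - c) < d) by (intro; rewrite Rminus_diag, Rabs_R0; exact Hd0).
  destruct (hunif (fun q => Rabs (fst q - rho) < d /\ Rabs (snd q - S) < d)) as [Hc _].
  - apply open_box.
  - exists (rho, S); simpl; split; apply Z.
  - intros [x y] [Hx Hy]; exact (proj1 (Hd x y Hx Hy)).
  - apply hnonconst, Hc; exists (p rho S); intros x y [Hx Hy]; simpl in Hx, Hy.
    transitivity (p rho y).
    + apply (zero_derivative_constant (fun x => p x y) rho d); [| exact Hx].
      intros u Hu; destruct (Hd u y Hu Hy) as [Du [E _]]; rewrite <- E.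
      apply C2_eos_is_derive, Du.
    + apply (zero_derivative_constant (fun y => p rho y) S d); [| exact Hy].
      intros u Hu; destruct (Hd rho u (Z rho) Hu) as [Du [_ E]]; rewrite <- E.
      apply C2_eos_is_derive, Du.
Qed.

(** On a box where [p_rho = 0] the equation of state is entropic with [kappa = p rho], and
    [uniform_type] spreads this to [D]. *)
Lemma not_locally_entropic (rho S : R) : ~ entropic_eos D p -> D (rho, S) ->
  ~ locally (rho, S) (fun q => Derive (fun x => p x (snd q)) (fst q) = 0).
Proof using hD hp hunif.
  intros hent H HP; destruct (box_around _ rho S H HP) as [d Hd]; simpl in Hd.
  assert (Hd0 := cond_pos d).
  assert (Z : forall c : R, Rabs (c - c) < d) by (intro; rewrite Rminus_diag, Rabs_R0; exact Hd0).
  destruct (hunif (fun q => Rabs (fst q - rho) < d /\ Rabs (snd q - S) < d)) as [_ Hc].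
  - apply open_box.
  - exists (rho, S); simpl; split; apply Z.
  - intros [x y] [Hx Hy]; exact (proj1 (Hd x y Hx Hy)).
  - apply hent, Hc; exists (p rho); intros x y [Hx Hy]; simpl in Hx, Hy.
    apply (zero_derivative_constant (fun x => p x y) rho d); [| exact Hx].
    intros u Hu; destruct (Hd u y Hu Hy) as [Du E]; rewrite <- E.
    apply C2_eos_is_derive, Du.
Qed.

(** If [f z] were nonzero, then so would [f] be nearby, and varying only [rho] and [S] would make
    [P] hold on a full neighbourhood. *)
Lemma zero_by_density (P : R * R -> Prop) (f : jet -> R) (z : jet) :
  continuous (f : (coord -> R) -> R) z ->
  near_jet z (fun y => f y <> 0 -> P (y c_rho, y c_S)) ->
  ~ locally (z c_rho, z c_S) P -> f z = 0.
Proof.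
  intros Hc HP HN; destruct (Req_dec (f z) 0) as [| N]; [assumption | exfalso; apply HN].
  assert (L := filter_and _ _ HP (Hc _ (open_neq 0 (f z) N))).
  destruct L as [d Hd]; exists d; intros [x y] [Hx Hy]; simpl in Hx, Hy.
  destruct (Hd (upd (upd z c_rho x) c_S y)) as [H1 H2].
  - intro j; unfold upd; destruct (Defs.eq_dec j c_S) as [-> |]; [exact Hy |].
    destruct (Defs.eq_dec j c_rho) as [-> |]; [exact Hx | apply ball_center].
  - exact (H1 H2).
Qed.

Variables (Om : jet -> Prop) (J : jet -> R).
Hypotheses (HOm : subset Om (jets_over D)) (HJ : scalar_invariant n p Om J).

Lemma jets_over_pos (z : jet) : Om z -> 0 < z c_r /\ 0 < z c_rho /\ D (z c_rho, z c_S).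
Proof using hD HOm.
  intro Hz; destruct (HOm z Hz) as [Hr Hd]; repeat split; try assumption.
  exact (proj1 (proj2 hD) _ _ Hd).
Qed.

Lemma flow_equation (z : jet) (Urr rhorr Srr : R) : Om z ->
  directional (flow_velocity n p z Urr rhorr Srr) J z = 0.
Proof using hD HOm HJ.
  intro Hz; rewrite <- material_derivative_directional; [apply (proj2 HJ), Hz | |];
    apply jets_over_pos, Hz.
Qed.

(** The variable [Urr] occurs only in the velocity of [rhor], with the nonzero coefficient [- rho];
    comparing [Urr = 0] and [Urr = 1] isolates it. *)
Lemma partial_rhor_zero (z : jet) : Om z -> partial c_rhor J z = 0.
Proof using hD HOm HJ.
  intro Hz; assert (E0 := flow_equation z 0 0 0 Hz); assert (E1 := flow_equation z 1 0 0 Hz).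
  destruct (jets_over_pos z Hz) as [_ [Hrho _]].
  unfold directional, flow_velocity in E0, E1; simpl in E0, E1.
  assert (F : z c_rho * partial c_rhor J z = 0) by lra.
  apply Rmult_integral in F; destruct F; [lra | assumption].
Qed.

Lemma partial_Ur_zero (z : jet) : Om z -> partial c_Ur J z = 0.
Proof using All.
  intro Hz; destruct (jets_over_pos z Hz) as [_ [_ Hd]].
  apply zero_by_density with (3 := not_locally_constant _ _ Hd).
  - apply (proj2 (proj1 HJ) z c_Ur Hz).
  - apply filter_imp with Om; [| exact (proj1 (proj1 HJ) z Hz)].
    intros y Hy HN; simpl; destruct (jets_over_pos y Hy) as [_ [Hrho _]].
    (* The coefficients of [rhorr] and [Srr] are [J_Ur] times [p_rho / rho] and [p_S / rho], up to
       sign; where [J_Ur] is nonzero, the gradient of [p] must vanish. *)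
    assert (E0 := flow_equation y 0 0 0 Hy); assert (E1 := flow_equation y 0 1 0 Hy).
    assert (E2 := flow_equation y 0 0 1 Hy).
    unfold directional, flow_velocity in E0, E1, E2; simpl in E0, E1, E2.
    change (p_rho p y = 0 /\ p_S p y = 0).
    assert (F1 : p_rho p y / y c_rho * partial c_Ur J y = 0) by lra.
    assert (F2 : p_S p y / y c_rho * partial c_Ur J y = 0) by lra.
    split.
    + replace (p_rho p y) with (p_rho p y / y c_rho * partial c_Ur J y * (y c_rho / partial c_Ur J y))
        by (field; lra).
      rewrite F1; ring.
    + replace (p_S p y) with (p_S p y / y c_rho * partial c_Ur J y * (y c_rho / partial c_Ur J y))
        by (field; lra).
      rewrite F2; ring.
Qed.

(** The two uncomputed velocities, total derivatives of the Euler right-hand sides, multiply [J_Ur]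
    and [J_rhor] and so drop out. *)
Lemma reduced_equation (z : jet) : Om z ->
  partial c_t J z + z c_U * partial c_r J z
  - (p_S p z * z c_Sr + p_rho p z * z c_rhor) / z c_rho * partial c_U J z
  - (z c_Ur * z c_rho + (INR n - 1) / z c_r * z c_U * z c_rho) * partial c_rho J z
  - z c_Ur * z c_Sr * partial c_Sr J z = 0.
Proof using All.
  intro Hz; assert (E := flow_equation z 0 0 0 Hz).
  unfold directional, flow_velocity in E; simpl in E.
  rewrite (partial_Ur_zero z Hz), (partial_rhor_zero z Hz) in E.
  rewrite <- E; unfold Rdiv; ring.
Qed.

Lemma locally_other (P : R -> Prop) (x : R) : locally x P -> exists y, y <> x /\ P y.
Proof.
  intros [d Hd]; assert (Hd0 := cond_pos d); exists (x + d / 2); split; [lra |].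
  apply Hd; unfold ball; simpl; unfold AbsRing_ball, abs, minus, plus, opp; simpl.
  replace (x + d / 2 + - x) with (d / 2) by ring; rewrite Rabs_pos_eq; lra.
Qed.

(** As [J_rhor = 0], moving [rhor] changes neither the other partials of [J] nor [p_rho] and [p_S];
    the difference of the two reduced equations is the coefficient of [rhor] times the
    displacement. *)
Lemma p_rho_partial_U (z : jet) : Om z -> p_rho p z * partial c_U J z = 0.
Proof using All.
  intro Hz; destruct (jets_over_pos z Hz) as [_ [Hrho _]].
  destruct (locally_other _ _ (partial_shift Om J z c_rhor (proj1 HJ) partial_rhor_zero Hz))
    as [x [Hx [Hz' Hs]]].
  assert (E := reduced_equation z Hz); assert (E' := reduced_equation _ Hz').
  repeat rewrite Hs in E' by discriminate; revert E'; unfold p_rho, p_S.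
  rewrite upd_same; repeat rewrite (upd_other z c_rhor) by discriminate; intro E'.
  fold (p_rho p z) (p_S p z) in E'.
  assert (F : (x - z c_rhor) / z c_rho * (p_rho p z * partial c_U J z) = 0).
  { match type of E with ?a = _ => match type of E' with ?b = _ => transitivity (a - b) end end.
    - unfold Rdiv; ring.
    - rewrite E, E'; ring. }
  apply Rmult_integral in F; destruct F as [F | F]; [exfalso | exact F].
  apply Rmult_integral in F; destruct F as [F | F]; [lra |].
  revert F; apply Rinv_neq_0_compat; lra.
Qed.

(** The coefficient of [Ur] in the reduced equation, isolated by moving [Ur], which is allowed since
    [J_Ur = 0]. *)
Lemma partial_rho_Sr (z : jet) : Om z ->
  z c_rho * partial c_rho J z + z c_Sr * partial c_Sr J z = 0.
Proof using All.
  intro Hz.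
  destruct (locally_other _ _ (partial_shift Om J z c_Ur (proj1 HJ) partial_Ur_zero Hz))
    as [x [Hx [Hz' Hs]]].
  assert (E := reduced_equation z Hz); assert (E' := reduced_equation _ Hz').
  repeat rewrite Hs in E' by discriminate; revert E'; unfold p_rho, p_S.
  rewrite upd_same; repeat rewrite (upd_other z c_Ur) by discriminate; intro E'.
  fold (p_rho p z) (p_S p z) in E'.
  assert (F : (x - z c_Ur) * (z c_rho * partial c_rho J z + z c_Sr * partial c_Sr J z) = 0).
  { match type of E with ?a = _ => match type of E' with ?b = _ => transitivity (a - b) end end.
    - unfold Rdiv; ring.
    - rewrite E, E'; ring. }
  apply Rmult_integral in F; destruct F as [F | F]; [exfalso; lra | exact F].
Qed.

Lemma transport_equation (z : jet) : Om z ->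
  partial c_t J z + z c_U * partial c_r J z
  - p_S p z * z c_Sr / z c_rho * partial c_U J z
  - (INR n - 1) / z c_r * z c_U * z c_rho * partial c_rho J z = 0.
Proof using All.
  intro Hz; assert (E := reduced_equation z Hz).
  assert (E1 := p_rho_partial_U z Hz); assert (E2 := partial_rho_Sr z Hz).
  transitivity (z c_rhor / z c_rho * (p_rho p z * partial c_U J z)
    + z c_Ur * (z c_rho * partial c_rho J z + z c_Sr * partial c_Sr J z)).
  - transitivity (0 + (z c_rhor / z c_rho * (p_rho p z * partial c_U J z)
    + z c_Ur * (z c_rho * partial c_rho J z + z c_Sr * partial c_Sr J z))); [| ring].
    rewrite <- E; unfold Rdiv; ring.
  - rewrite E1, E2; ring.
Qed.

Hypothesis hent : ~ entropic_eos D p.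

Lemma partial_U_zero (z : jet) : Om z -> partial c_U J z = 0.
Proof using All.
  intro Hz; destruct (jets_over_pos z Hz) as [_ [_ Hd]].
  apply zero_by_density with (3 := not_locally_entropic _ _ hent Hd).
  - apply (proj2 (proj1 HJ) z c_U Hz).
  - apply filter_imp with Om; [| exact (proj1 (proj1 HJ) z Hz)].
    intros y Hy HN; simpl; change (p_rho p y = 0).
    destruct (Rmult_integral _ _ (p_rho_partial_U y Hy)); [assumption | contradiction].
Qed.

(** Once [J_U = 0], the transport equation is affine in [U] with coefficients that do not change
    when [U] moves, so both coefficients vanish. *)
Lemma partial_t_r (z : jet) : Om z ->
  partial c_t J z = 0 /\
  partial c_r J z = (INR n - 1) / z c_r * z c_rho * partial c_rho J z.
Proof using All.
  intro Hz.
  destruct (locally_other _ _ (partial_shift Om J z c_U (proj1 HJ) partial_U_zero Hz))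
    as [x [Hx [Hz' Hs]]].
  assert (E := transport_equation z Hz); assert (E' := transport_equation _ Hz').
  rewrite partial_U_zero in E, E' by assumption.
  repeat rewrite Hs in E' by discriminate.
  rewrite upd_same in E'; repeat rewrite (upd_other z c_U) in E' by discriminate.
  set (X := partial c_r J z - (INR n - 1) / z c_r * z c_rho * partial c_rho J z).
  assert (F : partial c_t J z + z c_U * X = 0) by (rewrite <- E; unfold X; ring).
  assert (F' : partial c_t J z + x * X = 0) by (rewrite <- E'; unfold X; ring).
  assert (HX : (x - z c_U) * X = 0) by lra.
  apply Rmult_integral in HX; destruct HX as [HX | HX]; [exfalso; lra |].
  split; [rewrite HX in F; lra | unfold X in HX; lra].
Qed.

End Determining.

(** * The travel time integral *)

Lemma pow_le_1_mult (n : nat) (m x : R) : m < 1 -> 0 <= x <= 1 -> m * x ^ n < 1.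
Proof.
  intros Hm Hx; assert (0 <= x ^ n) by (apply pow_le; lra).
  assert (x ^ n <= 1) by (rewrite <- (pow1 n); apply pow_incr; exact Hx).
  destruct (Rle_dec m 0); nra.
Qed.

Section MomentIntegral.
Variables (n j : nat) (phi dphi : R -> R).
Hypothesis Hphi : forall y, y < 1 -> is_derive phi y (dphi y).
Hypothesis Hdphi : forall y, y < 1 -> continuous dphi y.

Lemma moment_continuous (m x : R) : m < 1 -> 0 <= x <= 1 ->
  continuous (fun x => x ^ j * phi (m * x ^ n)) x.
Proof using Hphi.
  intros Hm Hx.
  apply (continuous_mult (fun x => x ^ j) (fun x => phi (m * x ^ n))).
  - apply (ex_derive_continuous (K := R_AbsRing) (V := R_NormedModule)).
    auto_derive; exact Logic.I.
  - apply (continuous_comp (fun x => m * x ^ n) phi).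
    + apply (ex_derive_continuous (K := R_AbsRing) (V := R_NormedModule)).
      auto_derive; exact Logic.I.
    + apply (ex_derive_continuous (K := R_AbsRing) (V := R_NormedModule)).
      eexists; apply Hphi, pow_le_1_mult; assumption.
Qed.

Lemma moment_ex_RInt (m : R) : m < 1 -> ex_RInt (fun x => x ^ j * phi (m * x ^ n)) 0 1.
Proof using Hphi.
  intro Hm; apply (ex_RInt_continuous (V := R_CompleteNormedModule)); intros x Hx.
  rewrite Rmin_left, Rmax_right in Hx by lra.
  apply moment_continuous; assumption.
Qed.

Lemma moment_is_derive_integrand (m x : R) : m * x ^ n < 1 ->
  is_derive (fun m => x ^ j * phi (m * x ^ n)) m (x ^ (j + n) * dphi (m * x ^ n)).
Proof using Hphi.
  intro H; rewrite pow_add, Rmult_assoc.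
  apply (is_derive_scal (fun m => phi (m * x ^ n))).
  apply (is_derive_comp phi (fun m => m * x ^ n) m); [apply Hphi, H |].
  auto_derive; [exact Logic.I | ring].
Qed.

(** Differentiation under the integral sign raises the exponent [j] by [n] and replaces [phi] by its
    derivative. The form is closed under this step, so it yields both the derivative of [travel] and
    the continuity of that derivative. *)
Lemma moment_is_derive (m : R) : m < 1 ->
  is_derive (fun m => RInt (fun x => x ^ j * phi (m * x ^ n)) 0 1) m
    (RInt (fun x => x ^ (j + n) * dphi (m * x ^ n)) 0 1).
Proof using Hphi Hdphi.
  intro Hm.
  assert (L : locally m (fun y => y < 1)) by exact (open_lt 1 m Hm).
  rewrite (RInt_ext (fun x => x ^ (j + n) * dphi (m * x ^ n))
             (fun x => Derive (fun m => x ^ j * phi (m * x ^ n)) m)).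
  2:{ intros x Hx; rewrite Rmin_left, Rmax_right in Hx by lra.
      symmetry; apply is_derive_unique, moment_is_derive_integrand, pow_le_1_mult; lra. }
  apply (is_derive_RInt_param (fun m x => x ^ j * phi (m * x ^ n)) 0 1 m);
    rewrite ?Rmin_left, ?Rmax_right by lra.
  - revert L; apply filter_imp; intros y Hy x Hx; eexists.
    apply moment_is_derive_integrand, pow_le_1_mult; assumption.
  - intros x Hx.
    assert (Hmx : m * x ^ n < 1) by (apply pow_le_1_mult; assumption).
    assert (C' : forall k, continuity_2d_pt (fun _ v => v ^ k) m x).
    { intro k; apply continuity_1d_2d_pt_comp with (f := fun v => v ^ k) (g := fun _ v => v).
      - apply continuity_pt_filterlim, (ex_derive_continuous (K := R_AbsRing) (V := R_NormedModule)).
        auto_derive; exact Logic.I.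
      - apply continuity_2d_pt_id2. }
    assert (Cm : continuity_2d_pt (fun u v => u * v ^ n) m x).
    { apply continuity_2d_pt_mult; [apply continuity_2d_pt_id1 | apply C']. }
    apply continuity_2d_pt_ext_loc with (fun u v => v ^ (j + n) * dphi (u * v ^ n)).
    (* The gap to the singularity at 1 serves as tolerance: near [(m, x)] the argument stays below 1
       and the formula for the derivative holds. *)
    + assert (H0 : 0 < 1 - m * x ^ n) by lra.
      destruct (Cm (mkposreal _ H0)) as [d Hd]; exists d; intros u v Hu Hv.
      specialize (Hd u v Hu Hv); simpl in Hd; apply Rabs_def2 in Hd.
      symmetry; apply is_derive_unique, moment_is_derive_integrand; lra.
    + apply continuity_2d_pt_mult; [apply C' |].
      apply continuity_1d_2d_pt_comp with (f := dphi) (g := fun u v => u * v ^ n).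
      * apply continuity_pt_filterlim, Hdphi, Hmx.
      * exact Cm.
  - revert L; apply filter_imp; intros y Hy; apply moment_ex_RInt, Hy.
Qed.

End MomentIntegral.

(** The function [(1 - y)^(-1/2)], followed by its first and second derivatives. *)
Definition phi0 (y : R) : R := / sqrt (1 - y).
Definition phi1 (y : R) : R := / (2 * (1 - y) * sqrt (1 - y)).
Definition phi2 (y : R) : R := 3 / (4 * (1 - y) ^ 2 * sqrt (1 - y)).

Lemma phi0_is_derive (y : R) : y < 1 -> is_derive phi0 y (phi1 y).
Proof.
  intro Hy; assert (0 < sqrt (1 - y)) by (apply sqrt_lt_R0; lra).
  unfold phi0, phi1; auto_derive; replace (1 + - y) with (1 - y) by ring.
  - repeat split; lra.
  - rewrite <- (sqrt_sqrt (1 - y)) at 4 by lra; field; lra.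
Qed.

Lemma phi1_is_derive (y : R) : y < 1 -> is_derive phi1 y (phi2 y).
Proof.
  intro Hy; assert (Hs : 0 < sqrt (1 - y)) by (apply sqrt_lt_R0; lra).
  unfold phi1, phi2; auto_derive; replace (1 + - y) with (1 - y) by ring.
  - repeat split; try lra. apply Rgt_not_eq, Rmult_lt_0_compat; lra.
  - assert (E := sqrt_sqrt (1 - y)); set (s := sqrt (1 - y)) in *.
    rewrite <- E by lra; field; lra.
Qed.

Lemma phi2_continuous (y : R) : y < 1 -> continuous phi2 y.
Proof.
  intro Hy; assert (0 < sqrt (1 - y)) by (apply sqrt_lt_R0; lra).
  apply (ex_derive_continuous (K := R_AbsRing) (V := R_NormedModule)).
  unfold phi2; auto_derive; replace (1 + - y) with (1 - y) by ring; repeat split; try lra.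
  apply Rgt_not_eq; repeat apply Rmult_lt_0_compat; lra.
Qed.

Lemma phi1_continuous (y : R) : y < 1 -> continuous phi1 y.
Proof.
  intro Hy; apply (ex_derive_continuous (K := R_AbsRing) (V := R_NormedModule)).
  eexists; apply phi1_is_derive, Hy.
Qed.

(** By scaling, [RInt (fun y => / sqrt (E - k * y ^ n)) 0 r] is
    [r / sqrt E * travel n (k * r ^ n / E)]. *)
Definition travel (n : nat) (m : R) : R := RInt (fun x => x ^ 0 * phi0 (m * x ^ n)) 0 1.
Definition dtravel (n : nat) (m : R) : R := RInt (fun x => x ^ (0 + n) * phi1 (m * x ^ n)) 0 1.

Lemma travel_is_derive (n : nat) (m : R) : m < 1 -> is_derive (travel n) m (dtravel n m).
Proof.
  intro Hm; apply (moment_is_derive n 0 phi0 phi1 phi0_is_derive phi1_continuous m Hm).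
Qed.

Lemma dtravel_continuous (n : nat) (m : R) : m < 1 -> continuous (dtravel n) m.
Proof.
  intro Hm; apply (ex_derive_continuous (K := R_AbsRing) (V := R_NormedModule)).
  eexists.
  apply (moment_is_derive n (0 + n) phi1 phi2 phi1_is_derive phi2_continuous m Hm).
Qed.

(* The integrand of the left-hand side is the derivative of [x * phi0 (m * x ^ n)]. *)
Lemma travel_identity (n : nat) (m : R) : (0 < n)%nat -> m < 1 ->
  travel n m + INR n * m * dtravel n m = / sqrt (1 - m).
Proof.
  intros Hn Hm.
  assert (I1 := RInt_correct _ _ _ (moment_ex_RInt n 0 phi0 phi1 phi0_is_derive m Hm)).
  assert (I2 := RInt_correct _ _ _ (moment_ex_RInt n (0 + n) phi1 phi2 phi1_is_derive m Hm)).
  assert (I3 := is_RInt_plus _ _ _ _ _ _ I1 (is_RInt_scal _ _ _ (INR n * m) _ I2)).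
  assert (I4 : is_RInt (fun x => plus (x ^ 0 * phi0 (m * x ^ n))
                 (scal (INR n * m) (x ^ (0 + n) * phi1 (m * x ^ n)))) 0 1
                 (minus (1 * phi0 (m * 1 ^ n)) (0 * phi0 (m * 0 ^ n)))).
  { apply (is_RInt_derive (fun x => x * phi0 (m * x ^ n))); rewrite Rmin_left, Rmax_right by lra;
      intros x Hx.
    - assert (H1 := pow_le_1_mult n m x Hm Hx).
      replace (plus _ _) with (1 * phi0 (m * x ^ n) + x * ((m * (INR n * x ^ pred n)) * phi1 (m * x ^ n))).
      + apply (is_derive_mult (fun x => x) (fun x => phi0 (m * x ^ n))).
        * apply (is_derive_id x).
        * apply (is_derive_comp phi0 (fun x => m * x ^ n)); [apply phi0_is_derive, H1 |].
          auto_derive; [exact Logic.I | ring].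
        * intros; apply Rmult_comm.
      + unfold plus, scal; simpl; unfold mult; simpl.
        destruct n as [| n]; [lia |]; simpl pred; simpl pow; ring.
    - apply (continuous_plus (fun x => x ^ 0 * phi0 (m * x ^ n))).
      + apply (moment_continuous n 0 phi0 phi1 phi0_is_derive); assumption.
      + apply (continuous_scal_r (INR n * m) (fun x => x ^ (0 + n) * phi1 (m * x ^ n))).
        apply (moment_continuous n (0 + n) phi1 phi2 phi1_is_derive); assumption. }
  assert (E := eq_trans (eq_sym (is_RInt_unique _ _ _ _ I3)) (is_RInt_unique _ _ _ _ I4)).
  rewrite pow1, Rmult_1_r in E.
  transitivity (1 * phi0 m - 0 * phi0 (m * 0 ^ n)); [exact E | unfold phi0; ring].
Qed.

(** * Invariance *)

Lemma jets_over_open (D : R * R -> Prop) : eos_domain D ->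
  open_jets (jets_over D).
Proof.
  intros [HD _] z [Hr Hd]; apply filter_and.
  - exact (continuous_coord z c_r _ (open_gt 0 (z c_r) Hr)).
  - destruct (HD _ Hd) as [d H]; exists d; intros y Hy; apply H; split; apply Hy.
Qed.

Lemma scalar_invariant_subset (n : nat) (p : R -> R -> R) (Om Om' : jet -> Prop) (J : jet -> R) :
  open_jets Om' -> subset Om' Om ->
  scalar_invariant n p Om J -> scalar_invariant n p Om' J.
Proof.
  intros HO Hs [H1 H2]; split.
  - exact (C1_on_subset Om Om' J HO Hs H1).
  - intros z Hz; apply H2, Hs, Hz.
Qed.

Lemma INR_pred (n : nat) : (1 < n)%nat -> INR (n - 1) = INR n - 1.
Proof. intro H; rewrite minus_INR by lia; reflexivity. Qed.

Lemma pow_pred (r : R) (k : nat) : r <> 0 -> (0 < k)%nat -> r ^ pred k = r ^ k / r.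
Proof. intros Hr Hk; destruct k as [| k]; [lia |]; simpl; field; exact Hr. Qed.

Lemma pow_minus_1 (r : R) (n : nat) : r <> 0 -> (1 < n)%nat -> r ^ (n - 1) = r ^ n / r.
Proof. intros Hr Hn; rewrite <- pow_pred by (assumption || lia); f_equal; lia. Qed.

Section Invariants.
Variables (n : nat) (D : R * R -> Prop) (p : R -> R -> R).
Hypotheses (hn : (1 < n)%nat) (hD : eos_domain D) (hp : C2_eos D p).

Lemma INR_n_pos : 0 < INR n.
Proof using hn. apply lt_0_INR; lia. Qed.

Lemma jets_over_positive (z : jet) : jets_over D z -> 0 < z c_r /\ 0 < z c_rho.
Proof using hD. intros [H1 H2]; split; [exact H1 | exact (proj1 (proj2 hD) _ _ H2)]. Qed.

(** A straight line, not the jet of a solution: only its tangent at [s = 0] matters for first-order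
    equations. *)
Definition flow_line (z : jet) (Urr rhorr Srr s : R) : jet :=
  fun j => z j + s * flow_velocity n p z Urr rhorr Srr j.

Lemma flow_line_0 (z : jet) (Urr rhorr Srr : R) : flow_line z Urr rhorr Srr 0 = z.
Proof. apply functional_extensionality; intro j; unfold flow_line; ring. Qed.

Lemma flow_line_locally (z : jet) (Urr rhorr Srr : R) (P : jet -> Prop) :
  near_jet z P ->
  locally 0 (fun s => P (flow_line z Urr rhorr Srr s)).
Proof.
  intro H; refine (continuous_to_jet (flow_line z Urr rhorr Srr) 0 _ P _).
  - intro j; apply (ex_derive_continuous (K := R_AbsRing) (V := R_NormedModule)).
    unfold flow_line; auto_derive; exact Logic.I.
  - rewrite flow_line_0; exact H.
Qed.

(** Reduces invariance to an ordinary derivative at 0 in one variable, which can be computed without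
    evaluating the partials of [f]. *)
Lemma scalar_invariant_along_flow (Om : jet -> Prop) (f : jet -> R) :
  subset Om (jets_over D) -> C1_on Om f ->
  (forall z Urr rhorr Srr, Om z ->
     is_derive (fun s => f (flow_line z Urr rhorr Srr s)) 0 0) ->
  scalar_invariant n p Om f.
Proof using hD.
  intros Hs Hf H; split; [exact Hf |]; intros z Hz Urr rhorr Srr.
  destruct (jets_over_positive z (Hs z Hz)) as [Hr Hrho].
  rewrite material_derivative_directional by assumption.
  transitivity (Derive (fun s => f (flow_line z Urr rhorr Srr s)) 0);
    [symmetry | apply is_derive_unique, H, Hz].
  apply is_derive_unique.
  assert (C := is_derive_chain Om f (flow_line z Urr rhorr Srr) 0
                 (flow_velocity n p z Urr rhorr Srr) Hf).
  rewrite flow_line_0 in C; apply C; [exact Hz |].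
  intro j; unfold flow_line; auto_derive; [exact Logic.I | ring].
Qed.

Lemma inv_S_invariant : scalar_invariant n p (jets_over D) inv_S.
Proof using hD.
  apply scalar_invariant_along_flow; [intros z Hz; exact Hz | |].
  - apply C1c_C1_on, (C1c_coord (jets_over D) c_S), jets_over_open, hD.
  - intros z Urr rhorr Srr Hz; unfold inv_S, flow_line; simpl.
    auto_derive; [exact Logic.I | ring].
Qed.

Lemma inv_Sr_C1c : C1c (jets_over D) (inv_Sr n).
Proof using hD.
  assert (HO := jets_over_open D hD).
  apply (C1c_div (jets_over D) (fun z => z c_Sr) (fun z => z c_r ^ (n - 1) * z c_rho)).
  - intros z Hz; destruct (jets_over_positive z Hz) as [Hr Hrho].
    apply Rmult_integral_contrapositive; split; [apply pow_nonzero |]; lra.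
  - apply C1c_coord, HO.
  - apply (C1c_mult _ (fun z => z c_r ^ (n - 1))).
    + apply (C1c_pow _ (fun z => z c_r)), C1c_coord, HO.
    + apply C1c_coord, HO.
Qed.

(** The quantity is the derivative of [S] with respect to the mass coordinate whose differential is
    [r^(n-1) rho dr]. Along the flow both [Sr] and [r^(n-1) rho] scale at the rate [- Ur]. *)
Lemma inv_Sr_invariant : scalar_invariant n p (jets_over D) (inv_Sr n).
Proof using hn hD.
  apply scalar_invariant_along_flow; [intros z Hz; exact Hz | apply C1c_C1_on, inv_Sr_C1c |].
  intros z Urr rhorr Srr Hz; destruct (jets_over_positive z Hz) as [Hr Hrho].
  assert (Hp : z c_r ^ (n - 1) <> 0) by (apply pow_nonzero; lra).
  unfold inv_Sr, flow_line; simpl; auto_derive; rewrite !Rmult_0_l, !Rplus_0_r.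
  - apply Rmult_integral_contrapositive; split; [exact Hp | lra].
  - rewrite pow_pred, INR_pred by (lra || lia); field; repeat split; lra.
Qed.

(** * The additional invariants of an entropic equation of state *)

Variable kappa : R -> R.
Hypothesis hk : entropic_with kappa D p.

Lemma kappa_locally (rho S : R) : D (rho, S) -> locally S (fun y => p rho y = kappa y).
Proof using hD hk.
  intro H; destruct (proj1 hD _ H) as [d Hd]; exists d; intros y Hy; apply hk, Hd.
  split; [apply ball_center | exact Hy].
Qed.

Lemma kappa_p_S (z : jet) : D (z c_rho, z c_S) -> p_S p z = Derive kappa (z c_S).
Proof using hD hk. intro H; apply Derive_ext_loc, kappa_locally, H. Qed.

Lemma kappa_p_rho (z : jet) : D (z c_rho, z c_S) -> p_rho p z = 0.
Proof using hD hk.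
  intro H; transitivity (Derive (fun _ => kappa (z c_S)) (z c_rho)); [| apply Derive_const].
  apply Derive_ext_loc; destruct (proj1 hD _ H) as [d Hd]; exists d; intros y Hy; apply hk, Hd.
  split; [exact Hy | apply ball_center].
Qed.

(** Since [D] is open, [kappa] coincides near [S] with the section of [p] at fixed [rho], and
    inherits its second derivative and the continuity of that derivative. *)
Lemma kappa_C2 (rho S : R) : D (rho, S) ->
  is_derive (Derive kappa) S (Derive (Derive kappa) S) /\
  continuous (Derive (Derive kappa)) S.
Proof using hD hp hk.
  intro H; destruct (hp rho S H) as (_ & _ & _ & _ & _ & _ & H1 & _ & [H2 _]).
  assert (L := locally_locally _ _ (kappa_locally rho S H)).
  assert (L1 : locally S (fun y => Derive (fun x => p rho x) y = Derive kappa y)).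
  { revert L; apply filter_imp; intros y Hy; apply Derive_ext_loc, Hy. }
  assert (L2 : locally S (fun y => Derive (Derive (fun x => p rho x)) y = Derive (Derive kappa) y)).
  { generalize (locally_locally _ _ L1); apply filter_imp; intros y Hy.
    apply Derive_ext_loc, Hy. }
  split.
  - apply Derive_correct, ex_derive_ext_loc with (2 := H1); exact L1.
  - apply continuous_ext_loc with (Derive (Derive (fun x => p rho x))); [exact L2 |].
    apply filterlim_locally; intro eps; destruct (H2 eps) as [d Hd]; exists d; intros y Hy.
    apply Hd; [rewrite Rminus_diag, Rabs_R0; apply cond_pos | exact Hy].
Qed.

(** This is the term [k r^n] of the energy, with [w] expressed through [Sr]. *)
Definition amplitude (z : jet) : R := 2 / INR n * z c_r * Derive kappa (z c_S) * z c_Sr / z c_rho.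

Lemma inv_energy_amplitude (z : jet) : inv_energy n kappa z = z c_U ^ 2 + amplitude z.
Proof. reflexivity. Qed.

Lemma Derive_kappa_C1c (A : jet -> Prop) :
  open_jets A -> subset A (jets_over D) ->
  C1c A (fun z => Derive kappa (z c_S)).
Proof using hD hp hk.
  intros HO Hs; apply (C1c_comp (Derive kappa) (Derive (Derive kappa)) A (fun z => z c_S)).
  - intros z Hz; exact (kappa_C2 _ _ (proj2 (Hs z Hz))).
  - apply C1c_coord, HO.
Qed.

Lemma amplitude_C1c : C1c (jets_over D) amplitude.
Proof using hD hp hk.
  assert (HO := jets_over_open D hD); unfold amplitude.
  apply (C1c_div _ (fun z => 2 / INR n * z c_r * Derive kappa (z c_S) * z c_Sr)).
  - intros z Hz; destruct (jets_over_positive z Hz); lra.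
  - apply (C1c_mult _ (fun z => 2 / INR n * z c_r * Derive kappa (z c_S))); [| apply C1c_coord, HO].
    apply (C1c_mult _ (fun z => 2 / INR n * z c_r)).
    + apply (C1c_mult _ (fun _ => 2 / INR n)); [apply C1c_const | apply C1c_coord]; exact HO.
    + apply Derive_kappa_C1c; [exact HO | intros z Hz; exact Hz].
  - apply C1c_coord, HO.
Qed.

Lemma inv_energy_C1c : C1c (jets_over D) (inv_energy n kappa).
Proof using hD hp hk.
  apply (C1c_plus _ (fun z => z c_U ^ 2) amplitude); [| exact amplitude_C1c].
  apply (C1c_pow _ (fun z => z c_U)), C1c_coord, jets_over_open, hD.
Qed.

(** With [k] constant along the flow, [k r^n] changes only through [r], whose velocity is [U]. *)
Lemma amplitude_flow (z : jet) (Urr rhorr Srr : R) : jets_over D z ->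
  is_derive (fun s => amplitude (flow_line z Urr rhorr Srr s)) 0
    (INR n * amplitude z * z c_U / z c_r).
Proof using hn hD.
  intro Hz; destruct (jets_over_positive z Hz) as [Hr Hrho]; assert (Hn := INR_n_pos).
  apply is_derive_ext with (fun s => 2 / INR n * Derive kappa (z c_S) *
    ((z c_r + s * z c_U) * (z c_Sr + s * - (z c_Ur * z c_Sr)) /
     (z c_rho + s * - (z c_Ur * z c_rho + (INR n - 1) / z c_r * z c_U * z c_rho)))).
  - intro s; unfold amplitude, flow_line; simpl.
    replace (z c_S + s * 0) with (z c_S) by ring; unfold Rdiv; ring.
  - auto_derive; rewrite ?Rmult_0_l, ?Rplus_0_r; [lra |].
    unfold amplitude; field; repeat split; lra.
Qed.

(** The pressure force changes [U^2] at the rate [- 2 U kappa'(S) Sr / rho]. The factor [2 / n] in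
    the amplitude is what makes [n * amplitude * U / r] the opposite of this. *)
Lemma inv_energy_flow (z : jet) (Urr rhorr Srr : R) : jets_over D z ->
  is_derive (fun s => inv_energy n kappa (flow_line z Urr rhorr Srr s)) 0 0.
Proof using hn hD hk.
  intro Hz; destruct (jets_over_positive z Hz) as [Hr Hrho]; assert (Hn := INR_n_pos).
  replace 0 with (2 * z c_U * (- (Derive kappa (z c_S) * z c_Sr) / z c_rho)
                  + INR n * amplitude z * z c_U / z c_r) at 2
    by (unfold amplitude; field; lra).
  apply (is_derive_plus (fun s => flow_line z Urr rhorr Srr s c_U ^ 2)
          (fun s => amplitude (flow_line z Urr rhorr Srr s))); [| apply amplitude_flow, Hz].
  unfold flow_line; simpl; rewrite kappa_p_S, kappa_p_rho by apply Hz.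
  auto_derive; [exact Logic.I | field; lra].
Qed.

Lemma inv_energy_invariant : scalar_invariant n p (jets_over D) (inv_energy n kappa).
Proof using hn hD hp hk.
  apply scalar_invariant_along_flow; [intros z Hz; exact Hz | apply C1c_C1_on, inv_energy_C1c |].
  intros; apply inv_energy_flow; assumption.
Qed.

Lemma entropic_jets_open : open_jets (entropic_jets n kappa D).
Proof using hD hp hk.
  (* Writing [U <> 0] as [0 < U^2] turns each further condition into positivity of a continuous
     function. *)
  apply open_ext with (fun z => (jets_over D z /\ 0 < z c_U ^ 2) /\ 0 < inv_energy n kappa z).
  - intro z; unfold entropic_jets; assert (H := pow2_ge_0 (z c_U)); split.
    + intros [[H1 H2] H3]; repeat split; try apply H1; try assumption.
      intro E; rewrite E in H2; lra.
    + intros [H1 [H2 H3]]; repeat split; try apply H1; try assumption.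
      apply pow2_gt_0 in H2; lra.
  - apply (open_positive (fun z => jets_over D z /\ 0 < z c_U ^ 2)).
    + apply (open_positive (jets_over D) (fun z => z c_U ^ 2)); [apply jets_over_open, hD |].
      apply (C1c_pow _ (fun z => z c_U)), C1c_coord, jets_over_open, hD.
    + intros z [Hz _]; apply inv_energy_C1c, Hz.
Qed.

Lemma entropic_ratio (z : jet) : entropic_jets n kappa D z ->
  0 < z c_U ^ 2 /\ amplitude z / inv_energy n kappa z < 1.
Proof.
  intros [_ [HU HE]]; apply pow2_gt_0 in HU; split; [exact HU |].
  apply Rmult_lt_reg_r with (inv_energy n kappa z); [exact HE |].
  unfold Rdiv; rewrite Rmult_assoc, Rinv_l by lra.
  rewrite inv_energy_amplitude; lra.
Qed.

(** Under [y = r x] the radicand [U^2 + amplitude * (1 - x^n)] becomes [E * (1 - m x^n)] with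
    [m = amplitude / E], and [r / sqrt E] leaves the integral. *)
Lemma inv_time_travel (z : jet) : entropic_jets n kappa D z ->
  inv_time n kappa z =
  sign (z c_U) * (z c_r / sqrt (inv_energy n kappa z))
    * travel n (amplitude z / inv_energy n kappa z) - z c_t.
Proof using hD.
  intro Hz; destruct (entropic_ratio z Hz) as [HU2 Hm]; destruct Hz as [Hz [HU HE]].
  destruct (jets_over_positive z Hz) as [Hr Hrho].
  set (E := inv_energy n kappa z) in *; set (m := amplitude z / E) in *.
  assert (HsE := sqrt_lt_R0 E HE).
  assert (Hsg : sign (z c_U) * sign (z c_U) = 1).
  { destruct (Rtotal_order (z c_U) 0) as [H | [H | H]]; [| contradiction |].
    - rewrite (sign_eq_m1 _ H); ring.
    - rewrite (sign_eq_1 _ H); ring. }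
  assert (Hsg0 : sign (z c_U) <> 0) by (intro H; rewrite H in Hsg; lra).
  unfold inv_time; f_equal.
  set (c := sign (z c_U) * (z c_r / sqrt E)).
  set (f := fun x => c * (x ^ 0 * phi0 (m * x ^ n))).
  assert (If : ex_RInt (fun x => x ^ 0 * phi0 (m * x ^ n)) 0 1)
    by (apply moment_ex_RInt with phi1; [exact phi0_is_derive | exact Hm]).
  transitivity (RInt f 0 1); [| apply (RInt_scal (V := R_CompleteNormedModule)), If].
  transitivity (RInt f (/ z c_r * 0 + 0) (/ z c_r * z c_r + 0));
    [| f_equal; field; lra].
  rewrite <- (RInt_comp_lin (V := R_CompleteNormedModule)).
  2:{ replace (/ z c_r * 0 + 0) with 0 by ring.
      replace (/ z c_r * z c_r + 0) with 1 by (field; lra).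
      apply (ex_RInt_scal (V := R_NormedModule)), If. }
  apply (RInt_ext (V := R_CompleteNormedModule)); intros y Hy.
  rewrite Rmin_left, Rmax_right in Hy by lra.
  replace (/ z c_r * y + 0) with (y / z c_r) by (field; lra).
  assert (Hq : 0 <= y / z c_r <= 1).
  { split; [apply Rlt_le, Rdiv_lt_0_compat; lra |].
    apply Rmult_le_reg_r with (z c_r); [lra |]; unfold Rdiv; rewrite Rmult_assoc, Rinv_l; lra. }
  assert (H1 := pow_le_1_mult n m _ Hm Hq).
  set (q := y / z c_r) in *.
  replace (z c_U ^ 2 + 2 / INR n * (1 - q ^ n) * z c_r * Derive kappa (z c_S) * z c_Sr / z c_rho)
    with (E * (1 - m * q ^ n)).
  2:{ unfold m, Rdiv; replace (E * (1 - amplitude z * / E * q ^ n)) with (E - amplitude z * q ^ n)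
        by (field; lra).
      unfold E; rewrite inv_energy_amplitude; unfold amplitude, Rdiv; ring. }
  rewrite sqrt_mult by lra.
  assert (Hs : 0 < sqrt (1 - m * q ^ n)) by (apply sqrt_lt_R0; lra).
  unfold f, c, phi0, scal; simpl; unfold mult; simpl.
  (* The sign stands in the denominator on one side and in the numerator on the other; they agree
     because its square is 1. *)
  transitivity (sign (z c_U) * sign (z c_U) / (sign (z c_U) * (sqrt E * sqrt (1 - m * q ^ n)))).
  - rewrite Hsg; field; repeat split; lra.
  - field; repeat split; lra.
Qed.

Lemma sign_is_derive (x : R) : x <> 0 -> is_derive sign x 0.
Proof.
  intro Hx; destruct (Rtotal_order x 0) as [H | [H | H]]; [| contradiction |].
  - apply is_derive_ext_loc with (fun _ => -1); [| apply (is_derive_const (-1))].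
    apply filter_imp with (fun y => y < 0); [intros y Hy; symmetry; apply sign_eq_m1, Hy |].
    exact (open_lt 0 x H).
  - apply is_derive_ext_loc with (fun _ => 1); [| apply (is_derive_const 1)].
    apply filter_imp with (fun y => 0 < y); [intros y Hy; symmetry; apply sign_eq_1, Hy |].
    exact (open_gt 0 x H).
Qed.

Lemma inv_time_C1c : C1c (entropic_jets n kappa D) (inv_time n kappa).
Proof using hD hp hk.
  assert (HO := entropic_jets_open).
  assert (Hs : subset (entropic_jets n kappa D) (jets_over D)) by (intros z Hz; apply Hz).
  assert (CE := C1c_subset _ _ _ HO Hs inv_energy_C1c).
  assert (CA := C1c_subset _ _ _ HO Hs amplitude_C1c).
  apply C1c_ext with (fun z => sign (z c_U) * (z c_r / sqrt (inv_energy n kappa z))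
    * travel n (amplitude z / inv_energy n kappa z) - z c_t).
  { intros z Hz; symmetry; apply inv_time_travel, Hz. }
  apply (C1c_minus _ (fun z => sign (z c_U) * (z c_r / sqrt (inv_energy n kappa z))
    * travel n (amplitude z / inv_energy n kappa z)) (fun z => z c_t)); [| apply C1c_coord, HO].
  apply (C1c_mult _ (fun z => sign (z c_U) * (z c_r / sqrt (inv_energy n kappa z)))).
  - apply (C1c_mult _ (fun z => sign (z c_U))).
    + apply (C1c_comp sign (fun _ => 0) _ (fun z => z c_U)); [| apply C1c_coord, HO].
      intros z Hz; split; [apply sign_is_derive, Hz | apply continuous_const].
    + apply (C1c_div _ (fun z => z c_r) (fun z => sqrt (inv_energy n kappa z))).
      * intros z Hz; apply Rgt_not_eq, sqrt_lt_R0, Hz.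
      * apply C1c_coord, HO.
      * apply C1c_sqrt; [intros z Hz; apply Hz | exact CE].
  - apply (C1c_comp (travel n) (dtravel n) _ (fun z => amplitude z / inv_energy n kappa z)).
    + intros z Hz; apply entropic_ratio in Hz; split;
        [apply travel_is_derive | apply dtravel_continuous]; apply Hz.
    + apply C1c_div; [intros z Hz; apply Rgt_not_eq, Hz | exact CA | exact CE].
Qed.

(* Along the flow [inv_energy] is constant, so only [r], [amplitude] and [t] vary and
   the rate of change is given by [travel_identity]. *)
Lemma inv_time_flow (z : jet) (Urr rhorr Srr : R) : entropic_jets n kappa D z ->
  is_derive (fun s => inv_time n kappa (flow_line z Urr rhorr Srr s)) 0 0.
Proof using hn hD hp hk.
  intro Hz; destruct (entropic_ratio z Hz) as [HU2 Hm]; assert (Hz' := Hz).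
  destruct Hz' as [Hj [HU HE]].
  destruct (jets_over_positive z Hj) as [Hr Hrho].
  set (G := flow_line z Urr rhorr Srr).
  (* As [U <> 0], its sign is constant near [z] and can be frozen before differentiating. *)
  apply is_derive_ext_loc with (fun s => sign (z c_U) *
    (G s c_r / sqrt (inv_energy n kappa (G s))
     * travel n (amplitude (G s) / inv_energy n kappa (G s))) - G s c_t).
  { assert (HUc : near_jet z
                    (fun y => sign (y c_U) = sign (z c_U))).
    { destruct (Rtotal_order (z c_U) 0) as [H | [H | H]]; [| contradiction |].
      - assert (L := continuous_coord z c_U _ (open_lt 0 (z c_U) H)).
        unfold filtermap in L; revert L; apply filter_imp.
        intros y Hy; rewrite (sign_eq_m1 _ H); apply sign_eq_m1, Hy.
      - assert (L := continuous_coord z c_U _ (open_gt 0 (z c_U) H)).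
        unfold filtermap in L; revert L; apply filter_imp.
        intros y Hy; rewrite (sign_eq_1 _ H); apply sign_eq_1, Hy. }
    generalize (flow_line_locally z Urr rhorr Srr _
      (filter_and _ _ HUc (entropic_jets_open z Hz))); apply filter_imp.
    intros s [Hs1 Hs2]; unfold G; rewrite inv_time_travel by exact Hs2.
    rewrite Hs1; apply Rminus_diag_uniq; ring. }
  assert (dE := inv_energy_flow z Urr rhorr Srr Hj).
  assert (dA := amplitude_flow z Urr rhorr Srr Hj).
  fold G in dE, dA.
  assert (G0 : G 0 = z) by apply flow_line_0.
  set (A := fun s => amplitude (G s)) in *; set (E := fun s => inv_energy n kappa (G s)) in *.
  assert (E0 : E 0 = inv_energy n kappa z) by (unfold E; rewrite G0; reflexivity).
  assert (A0 : A 0 = amplitude z) by (unfold A; rewrite G0; reflexivity).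
  assert (Hid := travel_identity n (amplitude z / inv_energy n kappa z) ltac:(lia) Hm).
  assert (dT : is_derive (travel n) (A 0 / E 0) (dtravel n (amplitude z / inv_energy n kappa z))).
  { rewrite A0, E0; apply travel_is_derive, Hm. }
  assert (HsE := sqrt_lt_R0 _ HE).
  change (is_derive (fun s => sign (z c_U) * ((z c_r + s * z c_U) / sqrt (E s) * travel n (A s / E s))
    - (z c_t + s * 1)) 0 0).
  auto_derive.
  - repeat split; try (eexists; eassumption); try (rewrite E0; assumption); rewrite E0; lra.
  - assert (uE : Derive (fun s => E s) 0 = 0) by apply is_derive_unique, dE.
    assert (uA : Derive (fun s => A s) 0 = INR n * amplitude z * z c_U / z c_r)
      by apply is_derive_unique, dA.
    assert (uT : Derive (fun x => travel n x) (A 0 / E 0) = dtravel n (amplitude z / inv_energy n kappa z))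
      by apply is_derive_unique, dT.
    unfold Rdiv at 1 in uT; rewrite uE, uA, uT.
    rewrite A0, E0.
    set (e := inv_energy n kappa z) in *; set (a := amplitude z) in *.
    change (a * / e) with (a / e).
    transitivity (sign (z c_U) * z c_U / sqrt e * (travel n (a / e) + INR n * (a / e) * dtravel n (a / e)) - 1).
    + field; repeat split; lra.
    (* Since [e - a = U^2], the product of roots is the absolute value of [U]; the integral term
       thus grows at rate 1 and cancels the rate of [t]. *)
    + assert (Hs : sqrt e * sqrt (1 - a / e) = sign (z c_U) * z c_U).
      { rewrite <- sqrt_mult by lra.
        replace (e * (1 - a / e)) with (Rsqr (z c_U)).
        - rewrite sqrt_Rsqr_abs; destruct (Rtotal_order (z c_U) 0) as [H | [H | H]];
            [| contradiction |].
          + rewrite (sign_eq_m1 _ H), Rabs_left by exact H; ring.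
          + rewrite (sign_eq_1 _ H), Rabs_pos_eq by lra; ring.
        - replace (e * (1 - a / e)) with (e - a) by (field; lra).
          unfold e, a, Rsqr; rewrite inv_energy_amplitude; ring. }
      assert (0 < sqrt (1 - a / e)) by (apply sqrt_lt_R0; lra).
      rewrite Hid, <- Hs; field; lra.
Qed.

Lemma inv_time_invariant : scalar_invariant n p (entropic_jets n kappa D) (inv_time n kappa).
Proof using hn hD hp hk.
  apply scalar_invariant_along_flow; [intros z Hz; apply Hz | apply C1c_C1_on, inv_time_C1c |].
  intros; apply inv_time_flow; assumption.
Qed.

End Invariants.

(** * Classification *)

Lemma basic_invariants_upd (n : nat) (z : jet) (i : coord) (x : R) :
  i = c_U \/ i = c_t -> basic_invariants n (upd z i x) = basic_invariants n z.
Proof.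
  intros [-> | ->]; apply functional_extensionality; intros []; reflexivity.
Qed.

(** Neither basic invariant involves [U] or [t]. An invariant that varies in one of these variables
    is therefore an additional one. *)
Lemma basic_function_constant (n : nat) (Om : jet -> Prop) (J : jet -> R) (z : jet) (i : coord) :
  locally_function_of Om (basic_invariants n) J -> Om z -> i = c_U \/ i = c_t ->
  locally (z i) (fun x => J (upd z i x) = J z).
Proof.
  intros H Hz Hi; destruct (H z Hz) as (V & HV & HVz & _ & O & F & _ & E).
  apply filter_imp with (2 := upd_locally V z i HV HVz); intros x Hx.
  rewrite (proj2 (E _ Hx)), (proj2 (E _ HVz)), basic_invariants_upd by exact Hi; reflexivity.
Qed.

Lemma is_derive_upd (q : jet) (j k : coord) :
  is_derive (fun x => upd q j x k) (q j) (if Defs.eq_dec k j then 1 else 0).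
Proof.
  unfold upd; destruct (Defs.eq_dec k j); [apply (is_derive_id (q j)) | apply (is_derive_const (q k))].
Qed.

(** * Invariants for an equation of state that depends on the density *)

Section BasicCase.
Variables (n : nat) (D : R * R -> Prop) (p : R -> R -> R).
Hypotheses (hn : (1 < n)%nat) (hD : eos_domain D) (hp : C2_eos D p)
  (hunif : uniform_type D p) (hnonconst : ~ constant_eos D p) (hent : ~ entropic_eos D p).
Variables (Om : jet -> Prop) (J : jet -> R).
Hypotheses (HOm : subset Om (jets_over D)) (HJ : scalar_invariant n p Om J).

Definition basic_pos (i : basic_index) : coord :=
  match i with b_S => c_S | b_Sr => c_Sr end.
Definition basic_label (j : coord) : option basic_index :=
  match j with c_S => Some b_S | c_Sr => Some b_Sr | _ => None end.

Definition basic_W (q : jet) : Prop := 0 < q c_r /\ 0 < q c_rho.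
Definition basic_Q (z : jet) : jet := upd z c_Sr (inv_Sr n z).
Definition basic_Psi (q : jet) : jet := upd q c_Sr (q c_Sr * (q c_r ^ (n - 1) * q c_rho)).

Lemma basic_W_open : open_jets basic_W.
Proof.
  intros z [H1 H2]; apply filter_and.
  - exact (continuous_coord z c_r _ (open_gt 0 (z c_r) H1)).
  - exact (continuous_coord z c_rho _ (open_gt 0 (z c_rho) H2)).
Qed.

Lemma Sr_of_weight_C1c (W : jet -> Prop) :
  open_jets W ->
  C1c W (fun q => q c_Sr * (q c_r ^ (n - 1) * q c_rho)).
Proof.
  intro HW; apply (C1c_mult W (fun q => q c_Sr)); [apply C1c_coord, HW |].
  apply (C1c_mult W (fun q => q c_r ^ (n - 1))); [| apply C1c_coord, HW].
  apply (C1c_pow W (fun q => q c_r)), C1c_coord, HW.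
Qed.

Lemma basic_Psi_C1c (j : coord) : C1c basic_W (fun q => basic_Psi q j).
Proof.
  assert (HW := basic_W_open).
  destruct j; try exact (C1c_coord basic_W _ HW).
  apply Sr_of_weight_C1c, HW.
Qed.

Lemma basic_Q_spec (z : jet) : Om z ->
  basic_W (basic_Q z) /\ basic_Psi (basic_Q z) = z /\
  forall j, continuous (fun z' : coord -> R => basic_Q z' j) z.
Proof using hD HOm.
  intro Hz; destruct (jets_over_positive D hD z (HOm z Hz)) as [Hr Hrho].
  split; [split; assumption | split].
  - apply functional_extensionality; intros []; try reflexivity.
    unfold basic_Psi, basic_Q, inv_Sr, upd; simpl.
    assert (z c_r ^ (n - 1) <> 0) by (apply pow_nonzero; lra).
    field; split; lra.
  - intro j; destruct j; try apply continuous_coord.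
    apply (proj2 (inv_Sr_C1c n D hD)), HOm, Hz.
Qed.

Lemma basic_Q_Psi (q : jet) : basic_W q -> Om (basic_Psi q) -> forall i,
  basic_Q (basic_Psi q) (basic_pos i) = q (basic_pos i).
Proof.
  intros [Hr Hrho] _ [|]; [reflexivity |].
  unfold basic_Psi, basic_Q, inv_Sr, upd; simpl.
  assert (q c_r ^ (n - 1) <> 0) by (apply pow_nonzero; lra).
  field; split; lra.
Qed.

Lemma Sr_of_weight_is_derive_r (q : jet) : 0 < q c_r ->
  is_derive (fun x => q c_Sr * (x ^ (n - 1) * q c_rho)) (q c_r)
    ((INR n - 1) / q c_r * (q c_Sr * (q c_r ^ (n - 1) * q c_rho))).
Proof using hn.
  intro Hr; auto_derive; [exact Logic.I |].
  rewrite pow_pred, INR_pred by (lra || lia); field; lra.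
Qed.

(** At fixed [w], moving [r] or [rho] drags [Sr = w r^(n-1) rho] along. For [rho] the resulting
    derivative is the scaling equation divided by [rho]; for [r], the formula for [J_r] turns it
    into [(n-1)/r] times the scaling equation. The other free partials of [J] vanish outright. *)
Lemma basic_free (q : jet) (j : coord) :
  basic_W q -> Om (basic_Psi q) -> basic_label j = None ->
  is_derive (fun x => J (basic_Psi (upd q j x))) (q j) 0.
Proof using All.
  intros [Hr Hrho] Hq Hj; set (z := basic_Psi q) in *.
  assert (Ea := partial_Ur_zero n D p hD hp hunif hnonconst Om J HOm HJ z Hq).
  assert (Eb := partial_rhor_zero n D p hD Om J HOm HJ z Hq).
  assert (EU := partial_U_zero n D p hD hp hunif hnonconst Om J HOm HJ hent z Hq).
  destruct (partial_t_r n D p hD hp hunif hnonconst Om J HOm HJ hent z Hq) as [Et Er].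
  assert (Ec := partial_rho_Sr n D p hD hp hunif hnonconst Om J HOm HJ z Hq).
  assert (C : forall v : jet,
    (forall k, is_derive (fun x => basic_Psi (upd q j x) k) (q j) (v k)) ->
    directional v J z = 0 -> is_derive (fun x => J (basic_Psi (upd q j x))) (q j) 0).
  { intros v Hv E; rewrite <- E.
    replace z with (basic_Psi (upd q j (q j))) by (rewrite upd_id; reflexivity).
    apply (is_derive_chain Om J (fun x => basic_Psi (upd q j x)) (q j) v (proj1 HJ));
      [rewrite upd_id; exact Hq | exact Hv]. }
  assert (F : forall v : jet,
    directional v J z = v c_r * partial c_r J z + v c_rho * partial c_rho J z
      + v c_S * partial c_S J z + v c_Sr * partial c_Sr J z).
  { intro v; unfold directional; simpl; rewrite Ea, Eb, EU, Et; ring. }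
  destruct j; try discriminate Hj.
  - apply C with (jet_of 1 0 0 0 0 0 0 0); [| rewrite F; simpl; ring].
    intros []; try exact (is_derive_upd q c_t _); apply (is_derive_const (z c_Sr)).
  - apply C with (jet_of 0 1 0 0 0 0 0 ((INR n - 1) / q c_r * z c_Sr)).
    + intros []; try exact (is_derive_upd q c_r _); apply Sr_of_weight_is_derive_r, Hr.
    + rewrite F, Er; simpl.
      change (z c_r) with (q c_r).
      transitivity ((INR n - 1) / q c_r *
        (z c_rho * partial c_rho J z + z c_Sr * partial c_Sr J z)); [ring |].
      rewrite Ec; ring.
  - apply C with (jet_of 0 0 1 0 0 0 0 0); [| rewrite F; simpl; ring].
    intros []; try exact (is_derive_upd q c_U _); apply (is_derive_const (z c_Sr)).
  - apply C with (jet_of 0 0 0 1 0 0 0 (z c_Sr / q c_rho)).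
    + intros []; try exact (is_derive_upd q c_rho _).
      unfold z, basic_Psi, upd; simpl; auto_derive; [exact Logic.I | field; lra].
    + rewrite F; simpl.
      transitivity ((z c_rho * partial c_rho J z + z c_Sr * partial c_Sr J z) / q c_rho).
      * change (z c_rho) with (q c_rho); field; lra.
      * rewrite Ec; unfold Rdiv; ring.
  - apply C with (jet_of 0 0 0 0 0 1 0 0); [| rewrite F; simpl; ring].
    intros []; try exact (is_derive_upd q c_Ur _); apply (is_derive_const (z c_Sr)).
  - apply C with (jet_of 0 0 0 0 0 0 1 0); [| rewrite F; simpl; ring].
    intros []; try exact (is_derive_upd q c_rhor _); apply (is_derive_const (z c_Sr)).
Qed.

Lemma basic_pos_label (i : basic_index) (j : coord) : basic_label j = Some i -> j = basic_pos i.
Proof. destruct i, j; intro H; try discriminate H; reflexivity. Qed.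

Lemma basic_locally : locally_function_of Om (basic_invariants n) J.
Proof using All.
  apply (locally_function_of_straightened Om J basic_W basic_Psi basic_Q basic_pos basic_label).
  - apply HJ.
  - exact basic_W_open.
  - exact basic_Psi_C1c.
  - intros []; reflexivity.
  - exact basic_pos_label.
  - intros z []; reflexivity.
  - exact basic_Q_spec.
  - exact basic_Q_Psi.
  - exact basic_free.
Qed.

Lemma basic_globally : (forall z, jets_over D z -> Om z) -> function_of Om (basic_invariants n) J.
Proof using All.
  intro HD'.
  apply (function_of_convex_fibers Om J basic_W basic_Psi basic_Q basic_pos basic_label).
  - apply HJ.
  - exact basic_W_open.
  - exact basic_Psi_C1c.
  - intros []; reflexivity.
  - exact basic_pos_label.
  - intros z []; reflexivity.
  - exact basic_Q_spec.
  - exact basic_Q_Psi.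
  - exact basic_free.
  - intros z z' Hz Hz' E s Hs.
    set (q := segment (basic_Q z) (basic_Q z') s).
    destruct (HOm z Hz) as [Hr Hd], (HOm z' Hz') as [Hr' Hd'].
    assert (ES : z c_S = z' c_S) by exact (f_equal (fun f => f b_S) E).
    (* Along the segment [S] is fixed, so [rho] moves in a section of [D] at constant [S], an
       interval by the last clause of [eos_domain]. *)
    assert (H : jets_over D (basic_Psi q)).
    { split.
      - unfold q, segment, basic_Psi, basic_Q, upd; simpl; nra.
      - replace (basic_Psi q c_S) with (z c_S)
          by (unfold q, segment, basic_Psi, basic_Q, upd; simpl; rewrite ES; ring).
        rewrite <- ES in Hd'.
        unfold q, segment, basic_Psi, basic_Q, upd; simpl.
        destruct (Rle_dec (z c_rho) (z' c_rho)).
        + apply (proj2 (proj2 hD)) with (z c_rho) (z' c_rho); [assumption | assumption | nra].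
        + apply (proj2 (proj2 hD)) with (z' c_rho) (z c_rho); [assumption | assumption | nra]. }
    split; [exact (jets_over_positive D hD (basic_Psi q) H) | apply HD', H].
Qed.

End BasicCase.

(** * Invariants for an entropic equation of state *)

Section EntropicCase.
Variables (n : nat) (D : R * R -> Prop) (p : R -> R -> R).
Hypotheses (hn : (1 < n)%nat) (hD : eos_domain D) (hp : C2_eos D p)
  (hunif : uniform_type D p) (hnonconst : ~ constant_eos D p).
Variable kappa : R -> R.
Hypothesis hk : entropic_with kappa D p.
(** The sign of [U] on the domain considered, needed to recover [U] from the energy. *)
Variable sg : R.
Hypothesis Hsg : sg = 1 \/ sg = -1.

Lemma additional_energy (Om : jet -> Prop) :
  open_jets Om -> nonempty Om -> subset Om (jets_over D) ->
  additional_invariant n p Om (inv_energy n kappa).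
Proof using hn hD hp hk.
  intros HO [z Hz] Hs; split.
  - apply scalar_invariant_subset with (3 := inv_energy_invariant n D p hn hD hp kappa hk); assumption.
  - intro HL; destruct (basic_function_constant n Om _ z c_U HL Hz (or_introl eq_refl)) as [d Hd].
    assert (Hd0 := cond_pos d).
    assert (B : forall h, Rabs h < d -> ball (z c_U) d (z c_U + h)).
    { intros h Hh; unfold ball; simpl; unfold AbsRing_ball, abs, minus, plus, opp; simpl.
      replace (z c_U + h + - z c_U) with h by ring; exact Hh. }
    (* Two opposite displacements are needed: [U^2] may agree at [U] and [U + h], but agreement at
       both [U + h] and [U - h] forces [h = 0]. *)
    assert (E1 := Hd _ (B (d / 2) ltac:(rewrite Rabs_pos_eq; lra))).
    assert (E2 := Hd _ (B (- (d / 2)) ltac:(rewrite Rabs_Ropp, Rabs_pos_eq; lra))).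
    unfold inv_energy, upd in E1, E2; simpl in E1, E2; nra.
Qed.

Lemma additional_time (Om : jet -> Prop) :
  open_jets Om -> nonempty Om ->
  subset Om (entropic_jets n kappa D) ->
  additional_invariant n p Om (inv_time n kappa).
Proof using hn hD hp hk.
  intros HO [z Hz] Hs; split.
  - apply scalar_invariant_subset with (3 := inv_time_invariant n D p hn hD hp kappa hk); assumption.
  - intro HL.
    destruct (locally_other _ _ (basic_function_constant n Om _ z c_t HL Hz (or_intror eq_refl)))
      as [x [Hx E]].
    apply Hx; unfold inv_time, upd in E; simpl in E.
    apply Rplus_eq_reg_l in E; lra.
Qed.

Definition entropic_pos (i : entropic_index) : coord :=
  match i with e_S => c_S | e_Sr => c_Sr | e_energy => c_U | e_time => c_t end.
Definition entropic_label (j : coord) : option entropic_index :=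
  match j with
  | c_S => Some e_S | c_Sr => Some e_Sr | c_U => Some e_energy | c_t => Some e_time
  | _ => None
  end.

(** In straightened coordinates [c_t], [c_U], [c_Sr] hold the values of [inv_time],
    [inv_energy], [inv_Sr]; the velocity at radius [r] is then [sg * sqrt (radicand q)]. *)
Definition rate (q : jet) : R := 2 / INR n * Derive kappa (q c_S) * q c_Sr.
Definition radicand (q : jet) : R := q c_U - rate q * q c_r ^ n.

Definition entropic_W (q : jet) : Prop := (jets_over D q /\ 0 < q c_U) /\ 0 < radicand q.
Definition entropic_Q (z : jet) : jet :=
  jet_of (inv_time n kappa z) (z c_r) (inv_energy n kappa z) (z c_rho) (z c_S)
    (z c_Ur) (z c_rhor) (inv_Sr n z).
Definition entropic_Psi (q : jet) : jet :=
  jet_of (sg * (q c_r / sqrt (q c_U)) * travel n (rate q * q c_r ^ n / q c_U) - q c_t)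
    (q c_r) (sg * sqrt (radicand q)) (q c_rho) (q c_S) (q c_Ur) (q c_rhor)
    (q c_Sr * (q c_r ^ (n - 1) * q c_rho)).

Lemma entropic_W0_open :
  open_jets (fun q => jets_over D q /\ 0 < q c_U).
Proof using hD.
  apply (open_positive (jets_over D) (fun q => q c_U)); [apply jets_over_open, hD |].
  intros z _; apply continuous_coord.
Qed.

Lemma rate_pow_C1c (W : jet -> Prop) :
  open_jets W -> subset W (jets_over D) ->
  C1c W (fun q => rate q * q c_r ^ n).
Proof using hD hp hk.
  intros HO Hs; apply (C1c_mult W rate).
  - apply (C1c_mult W (fun q => 2 / INR n * Derive kappa (q c_S))); [| apply C1c_coord, HO].
    apply (C1c_mult W (fun _ => 2 / INR n)); [apply C1c_const, HO |].
    apply (Derive_kappa_C1c D p hD hp kappa hk); assumption.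
  - apply (C1c_pow W (fun q => q c_r)), C1c_coord, HO.
Qed.

Lemma radicand_C1c (W : jet -> Prop) :
  open_jets W -> subset W (jets_over D) -> C1c W radicand.
Proof using hD hp hk.
  intros HO Hs; apply (C1c_minus W (fun q => q c_U)); [apply C1c_coord, HO |].
  apply rate_pow_C1c; assumption.
Qed.

Lemma entropic_W_open : open_jets entropic_W.
Proof using hD hp hk.
  apply (open_positive (fun q => jets_over D q /\ 0 < q c_U)); [exact entropic_W0_open |].
  intros z Hz; apply (radicand_C1c _ entropic_W0_open); [intros x Hx; apply Hx | exact Hz].
Qed.

Lemma entropic_W_ratio (q : jet) : entropic_W q -> rate q * q c_r ^ n / q c_U < 1.
Proof.
  intros [[_ HU] HR]; apply Rmult_lt_reg_r with (q c_U); [exact HU |].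
  unfold Rdiv; rewrite Rmult_assoc, Rinv_l by lra; unfold radicand in HR; lra.
Qed.

Lemma entropic_Psi_C1c (j : coord) : C1c entropic_W (fun q => entropic_Psi q j).
Proof using hD hp hk.
  assert (HW := entropic_W_open).
  assert (Hs : subset entropic_W (jets_over D)) by (intros z Hz; apply Hz).
  destruct j; try exact (C1c_coord entropic_W _ HW); simpl.
  - apply (C1c_minus entropic_W (fun q => sg * (q c_r / sqrt (q c_U)) * travel n (rate q * q c_r ^ n / q c_U)));
      [| apply C1c_coord, HW].
    apply (C1c_mult entropic_W (fun q => sg * (q c_r / sqrt (q c_U)))).
    + apply (C1c_mult entropic_W (fun _ => sg)); [apply C1c_const, HW |].
      apply (C1c_div entropic_W (fun q => q c_r) (fun q => sqrt (q c_U))).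
      * intros q Hq; apply Rgt_not_eq, sqrt_lt_R0, Hq.
      * apply C1c_coord, HW.
      * apply (C1c_sqrt entropic_W (fun q => q c_U)); [intros q Hq; apply Hq | apply C1c_coord, HW].
    + apply (C1c_comp (travel n) (dtravel n) entropic_W (fun q => rate q * q c_r ^ n / q c_U)).
      * intros q Hq; apply entropic_W_ratio in Hq; split;
          [apply travel_is_derive | apply dtravel_continuous]; exact Hq.
      * apply (C1c_div entropic_W (fun q => rate q * q c_r ^ n) (fun q => q c_U)).
        -- intros q Hq; apply Rgt_not_eq, Hq.
        -- apply rate_pow_C1c; assumption.
        -- apply C1c_coord, HW.
  - apply (C1c_mult entropic_W (fun _ => sg)); [apply C1c_const, HW |].
    apply C1c_sqrt; [intros q Hq; apply Hq | apply radicand_C1c; assumption].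
  - apply Sr_of_weight_C1c, HW.
Qed.

Lemma rate_Q (z : jet) : jets_over D z -> rate (entropic_Q z) * z c_r ^ n = amplitude n kappa z.
Proof using hn hD.
  intro Hz; destruct (jets_over_positive D hD z Hz) as [Hr Hrho]; assert (Hn := INR_n_pos n hn).
  unfold rate, amplitude, entropic_Q, inv_Sr; simpl.
  rewrite pow_minus_1 by (lra || lia).
  assert (z c_r ^ n <> 0) by (apply pow_nonzero; lra).
  field; repeat split; lra.
Qed.

Lemma amplitude_Psi (q : jet) : jets_over D q -> amplitude n kappa (entropic_Psi q) = rate q * q c_r ^ n.
Proof using hn hD.
  intro Hz; destruct (jets_over_positive D hD q Hz) as [Hr Hrho]; assert (Hn := INR_n_pos n hn).
  unfold rate, amplitude; simpl; rewrite pow_minus_1 by (lra || lia).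
  field; repeat split; lra.
Qed.

Lemma energy_Psi (q : jet) : entropic_W q -> inv_energy n kappa (entropic_Psi q) = q c_U.
Proof using hn hD Hsg.
  intros [[Hj HU] HR]; rewrite inv_energy_amplitude, amplitude_Psi by exact Hj; simpl.
  assert (E := sqrt_sqrt (radicand q) (Rlt_le _ _ HR)); unfold radicand in E at 3.
  destruct Hsg as [-> | ->]; lra.
Qed.

Lemma sg_sqrt_nonzero (x : R) : 0 < x -> sg * sqrt x <> 0 /\ 0 < sg * (sg * sqrt x) /\
  sign (sg * sqrt x) = sg.
Proof using Hsg.
  intro Hx; assert (H := sqrt_lt_R0 x Hx); destruct Hsg as [-> | ->]; repeat split; try lra.
  - apply sign_eq_1; lra.
  - apply sign_eq_m1; lra.
Qed.

Lemma entropic_jets_Psi (q : jet) : entropic_W q ->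
  entropic_jets n kappa D (entropic_Psi q) /\ 0 < sg * entropic_Psi q c_U.
Proof using hn hD Hsg.
  intro Hq; assert (E := energy_Psi q Hq); destruct Hq as [[Hj HU] HR].
  destruct (sg_sqrt_nonzero _ HR) as [H1 [H2 _]].
  split; [| exact H2]; split; [exact Hj | split; [exact H1 | rewrite E; exact HU]].
Qed.

Variables (Om : jet -> Prop) (J : jet -> R).
Hypotheses (HOm : subset Om (fun z => entropic_jets n kappa D z /\ 0 < sg * z c_U))
  (HJ : scalar_invariant n p Om J).

Lemma entropic_Q_spec (z : jet) : Om z ->
  entropic_W (entropic_Q z) /\ entropic_Psi (entropic_Q z) = z /\
  forall j, continuous (fun z' : coord -> R => entropic_Q z' j) z.
Proof using hn hD hp hk Hsg HOm.
  intro Hz; destruct (HOm z Hz) as [He Hs]; assert (Hj := proj1 He).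
  destruct (entropic_ratio n D kappa z He) as [HU2 _].
  (* The radicand is the energy minus the amplitude. Its root is the absolute value of [U], and [sg]
     restores the sign. *)
  assert (HR : radicand (entropic_Q z) = (z c_U)²).
  { unfold radicand; change (entropic_Q z c_r) with (z c_r); rewrite rate_Q by exact Hj.
    change (entropic_Q z c_U) with (inv_energy n kappa z).
    rewrite inv_energy_amplitude; unfold Rsqr; ring. }
  assert (Hsign : sign (z c_U) = sg /\ sg * Rabs (z c_U) = z c_U).
  { destruct Hsg as [-> | ->].
    - split; [apply sign_eq_1; lra | rewrite Rabs_pos_eq; lra].
    - split; [apply sign_eq_m1; lra | rewrite Rabs_left; lra]. }
  split; [| split].
  - split; [split; [exact Hj | apply He] | rewrite HR; unfold Rsqr; nra].
  - apply functional_extensionality; intro j; destruct j; try reflexivity.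
    + unfold entropic_Psi, jet_of; change (entropic_Q z c_r) with (z c_r).
      rewrite rate_Q by exact Hj; simpl.
      rewrite (inv_time_travel n D hD kappa z He), (proj1 Hsign); ring.
    + unfold entropic_Psi, jet_of; rewrite HR, sqrt_Rsqr_abs; apply Hsign.
    + exact (f_equal (fun f => f c_Sr) (proj1 (proj2
        (basic_Q_spec n D hD (jets_over D) (fun x Hx => Hx) z Hj)))).
  - intro j; destruct j; try apply continuous_coord.
    + apply (proj2 (inv_time_C1c n D p hD hp kappa hk)), He.
    + apply (proj2 (inv_energy_C1c n D p hD hp kappa hk)), Hj.
    + apply (proj2 (inv_Sr_C1c n D hD)), Hj.
Qed.

Lemma entropic_Q_Psi (q : jet) : entropic_W q -> Om (entropic_Psi q) -> forall i,
  entropic_Q (entropic_Psi q) (entropic_pos i) = q (entropic_pos i).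
Proof using hn hD Hsg.
  intros Hq _ i; assert (E := energy_Psi q Hq).
  destruct (jets_over_positive D hD q (proj1 (proj1 Hq))) as [Hr Hrho].
  destruct i; unfold entropic_Q, entropic_pos, jet_of.
  - reflexivity.
  - apply (basic_Q_Psi n (fun _ => True) q (conj Hr Hrho) Logic.I b_Sr).
  - exact E.
  - rewrite (inv_time_travel n D hD kappa) by (apply entropic_jets_Psi, Hq).
    rewrite E, amplitude_Psi by apply Hq; simpl.
    rewrite (proj2 (proj2 (sg_sqrt_nonzero _ (proj2 Hq)))); ring.
Qed.

(** Varying [r] at fixed [S], [w], energy and time invariant moves the jet along a characteristic of
    the transport equation; varying [rho] moves only [rho] and [Sr], along the scaling direction. *)
Lemma entropic_free (q : jet) (j : coord) :
  entropic_W q -> Om (entropic_Psi q) -> entropic_label j = None ->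
  is_derive (fun x => J (entropic_Psi (upd q j x))) (q j) 0.
Proof using All.
  intros HW Hq Hj; set (z := entropic_Psi q) in *.
  assert (HOm' : subset Om (jets_over D)) by (intros y Hy; apply (HOm y Hy)).
  assert (Ea := partial_Ur_zero n D p hD hp hunif hnonconst Om J HOm' HJ z Hq).
  assert (Eb := partial_rhor_zero n D p hD Om J HOm' HJ z Hq).
  assert (ET := transport_equation n D p hD hp hunif hnonconst Om J HOm' HJ z Hq).
  rewrite (kappa_p_S D p hD kappa hk) in ET by apply HW.
  assert (Ec := partial_rho_Sr n D p hD hp hunif hnonconst Om J HOm' HJ z Hq).
  assert (Hm := entropic_W_ratio q HW).
  destruct HW as [[Hjets HE] HR]; destruct (jets_over_positive D hD q Hjets) as [Hr Hrho].
  destruct (sg_sqrt_nonzero _ HR) as [HU _]; change (sg * sqrt (radicand q)) with (z c_U) in HU.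
  assert (C : forall v : jet,
    (forall k, is_derive (fun x => entropic_Psi (upd q j x) k) (q j) (v k)) ->
    directional v J z = 0 -> is_derive (fun x => J (entropic_Psi (upd q j x))) (q j) 0).
  { intros v Hv E; rewrite <- E.
    replace z with (entropic_Psi (upd q j (q j))) by (rewrite upd_id; reflexivity).
    apply (is_derive_chain Om J (fun x => entropic_Psi (upd q j x)) (q j) v (proj1 HJ));
      [rewrite upd_id; exact Hq | exact Hv]. }
  assert (F : forall v : jet,
    directional v J z = v c_t * partial c_t J z + v c_r * partial c_r J z
      + v c_U * partial c_U J z + v c_rho * partial c_rho J z
      + v c_S * partial c_S J z + v c_Sr * partial c_Sr J z).
  { intro v; unfold directional; simpl; rewrite Ea, Eb; ring. }
  destruct j; try discriminate Hj.
  (* The characteristic parametrized by [r]: [dt/dr = 1/U], [dU/dr] is the force divided by [U], and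
     [Sr] follows [r^(n-1)]. Along it the derivative of [J] is the transport equation over [U] plus
     [(n-1)/r] times the scaling equation. *)
  - apply C with (jet_of (/ z c_U) 1 (- (Derive kappa (q c_S) * z c_Sr / q c_rho / z c_U))
                    0 0 0 0 ((INR n - 1) / q c_r * z c_Sr)).
    + assert (Hs := sqrt_lt_R0 _ HR); assert (HsE := sqrt_lt_R0 _ HE).
      assert (Hn := INR_n_pos n hn).
      intros []; try exact (is_derive_upd q c_r _).
      * assert (dT := travel_is_derive n _ Hm).
        assert (uT : Derive (fun x => travel n x) (rate q * q c_r ^ n / q c_U)
                     = dtravel n (rate q * q c_r ^ n / q c_U)) by apply is_derive_unique, dT.
        change (is_derive (fun x => sg * (x / sqrt (q c_U)) * travel n (rate q * x ^ n / q c_U) - q c_t)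
                  (q c_r) (/ z c_U)).
        assert (Hid := travel_identity n _ ltac:(lia) Hm).
        auto_derive; [repeat split; eexists; exact dT |].
        change (rate q * q c_r ^ n * / q c_U) with (rate q * q c_r ^ n / q c_U).
        rewrite uT, pow_pred by (lra || lia).
        set (m := rate q * q c_r ^ n / q c_U) in *.
        (* The derivative of [r * travel n m] in [r], with [m] proportional to [r^n], is the
           left-hand side of [travel_identity]; what results is [1/U] because [sg] is its own
           inverse. *)
        transitivity (sg / sqrt (q c_U) * (travel n m + INR n * m * dtravel n m)).
        -- unfold m; field; repeat split; lra.
        -- rewrite Hid; change (z c_U) with (sg * sqrt (radicand q)).
           replace (radicand q) with (q c_U * (1 - m)) by (unfold m, radicand; field; lra).
           rewrite sqrt_mult by lra.
           assert (0 < sqrt (1 - m)) by (apply sqrt_lt_R0; lra).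
           destruct Hsg as [-> | ->]; field; repeat split; lra.
      * change (is_derive (fun x => sg * sqrt (q c_U - rate q * x ^ n)) (q c_r)
                  (- (Derive kappa (q c_S) * z c_Sr / q c_rho / z c_U))).
        auto_derive; [exact HR |].
        change (q c_U + - (rate q * q c_r ^ n)) with (radicand q).
        rewrite pow_pred by (lra || lia).
        change (z c_U) with (sg * sqrt (radicand q)).
        change (z c_Sr) with (q c_Sr * (q c_r ^ (n - 1) * q c_rho)).
        rewrite pow_minus_1 by (lra || lia); unfold rate.
        destruct Hsg as [-> | ->]; field; repeat split; lra.
      * apply Sr_of_weight_is_derive_r; assumption.
    + rewrite F; cbv beta iota delta [jet_of].
      match type of ET with ?a = 0 =>
        transitivity (a / z c_U + (INR n - 1) / q c_r *
          (z c_rho * partial c_rho J z + z c_Sr * partial c_Sr J z)) end.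
      * change (z c_r) with (q c_r); change (z c_rho) with (q c_rho); change (z c_S) with (q c_S).
        field; repeat split; lra.
      * rewrite ET, Ec; unfold Rdiv; ring.
  - apply C with (jet_of 0 0 0 1 0 0 0 (z c_Sr / q c_rho)).
    + intros []; try exact (is_derive_upd q c_rho _).
      * apply (is_derive_const (z c_t)).
      * apply (is_derive_const (z c_U)).
      * unfold z, entropic_Psi, upd; simpl; auto_derive; [exact Logic.I | field; lra].
    + rewrite F; cbv beta iota delta [jet_of].
      transitivity ((z c_rho * partial c_rho J z + z c_Sr * partial c_Sr J z) / q c_rho).
      * change (z c_rho) with (q c_rho); field; lra.
      * rewrite Ec; unfold Rdiv; ring.
  - apply C with (jet_of 0 0 0 0 0 1 0 0); [| rewrite F; simpl; ring].
    intros []; try exact (is_derive_upd q c_Ur _);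
      [apply (is_derive_const (z c_t)) | apply (is_derive_const (z c_U)) | apply (is_derive_const (z c_Sr))].
  - apply C with (jet_of 0 0 0 0 0 0 1 0); [| rewrite F; simpl; ring].
    intros []; try exact (is_derive_upd q c_rhor _);
      [apply (is_derive_const (z c_t)) | apply (is_derive_const (z c_U)) | apply (is_derive_const (z c_Sr))].
Qed.

Lemma entropic_pos_label (i : entropic_index) (j : coord) :
  entropic_label j = Some i -> j = entropic_pos i.
Proof. destruct i, j; intro H; try discriminate H; reflexivity. Qed.

Lemma entropic_locally : locally_function_of Om (entropic_invariants n kappa) J.
Proof using All.
  apply (locally_function_of_straightened Om J entropic_W entropic_Psi entropic_Q
           entropic_pos entropic_label).
  - apply HJ.
  - exact entropic_W_open.
  - exact entropic_Psi_C1c.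
  - intros []; reflexivity.
  - exact entropic_pos_label.
  - intros z []; reflexivity.
  - exact entropic_Q_spec.
  - exact entropic_Q_Psi.
  - exact entropic_free.
Qed.

Lemma entropic_globally :
  (forall z, entropic_jets n kappa D z /\ 0 < sg * z c_U -> Om z) ->
  function_of Om (entropic_invariants n kappa) J.
Proof using All.
  intro HD'.
  apply (function_of_convex_fibers Om J entropic_W entropic_Psi entropic_Q
           entropic_pos entropic_label).
  - apply HJ.
  - exact entropic_W_open.
  - exact entropic_Psi_C1c.
  - intros []; reflexivity.
  - exact entropic_pos_label.
  - intros z []; reflexivity.
  - exact entropic_Q_spec.
  - exact entropic_Q_Psi.
  - exact entropic_free.
  - intros z z' Hz Hz' E s Hs.
    set (q := segment (entropic_Q z) (entropic_Q z') s).
    destruct (entropic_Q_spec z Hz) as [[[[Hr Hd] HE] HR] _].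
    destruct (entropic_Q_spec z' Hz') as [[[[Hr' Hd'] HE'] HR'] _].
    assert (ES : entropic_Q z' c_S = entropic_Q z c_S)
      by exact (eq_sym (f_equal (fun f => f e_S) E)).
    assert (EU : entropic_Q z' c_U = entropic_Q z c_U)
      by exact (eq_sym (f_equal (fun f => f e_energy) E)).
    assert (Ew : entropic_Q z' c_Sr = entropic_Q z c_Sr)
      by exact (eq_sym (f_equal (fun f => f e_Sr) E)).
    assert (qS : q c_S = entropic_Q z c_S) by (unfold q, segment; rewrite ES; ring).
    assert (qU : q c_U = entropic_Q z c_U) by (unfold q, segment; rewrite EU; ring).
    assert (qw : q c_Sr = entropic_Q z c_Sr) by (unfold q, segment; rewrite Ew; ring).
    rewrite ES in Hd'.
    assert (Hq : entropic_W q).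
    { split; [split; [split |] |].
      - unfold q, segment; nra.
      - rewrite qS; unfold q, segment.
        destruct (Rle_dec (entropic_Q z c_rho) (entropic_Q z' c_rho)).
        + apply (proj2 (proj2 hD)) with (entropic_Q z c_rho) (entropic_Q z' c_rho);
            [assumption | assumption | nra].
        + apply (proj2 (proj2 hD)) with (entropic_Q z' c_rho) (entropic_Q z c_rho);
            [assumption | assumption | nra].
      - rewrite qU; exact HE.
      (* On a fibre [k] and [E] are fixed and the condition is [k r^n < E]. It holds for [k <= 0]
         since [E > 0]; for [k > 0] it follows from the endpoint with the larger radius. *)
      - unfold radicand, rate in *; rewrite qS, qU, qw; rewrite ES, EU, Ew in HR'.
        set (k := 2 / INR n * Derive kappa (entropic_Q z c_S) * entropic_Q z c_Sr) in *.
        assert (Hqr : 0 < q c_r) by (unfold q, segment; nra).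
        assert (Hqn : 0 < q c_r ^ n) by (apply pow_lt, Hqr).
        destruct (Rle_dec k 0); [nra |].
        destruct (Rle_dec (entropic_Q z c_r) (entropic_Q z' c_r)).
        + assert (q c_r ^ n <= entropic_Q z' c_r ^ n)
            by (apply pow_incr; split; [lra | unfold q, segment; nra]).
          nra.
        + assert (q c_r ^ n <= entropic_Q z c_r ^ n)
            by (apply pow_incr; split; [lra | unfold q, segment; nra]).
          nra. }
    split; [exact Hq | apply HD', entropic_jets_Psi, Hq].
Qed.

End EntropicCase.

Theorem theorem3p3 (n : nat) (hn : (1 < n)%nat)
  (D : R * R -> Prop) (hD : eos_domain D)
  (p : R -> R -> R) (hp : C2_eos D p)
  (hunif : uniform_type D p) (hnonconst : ~ constant_eos D p) :
  (* (i) *)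
  (scalar_invariant n p (jets_over D) inv_S /\
   scalar_invariant n p (jets_over D) (inv_Sr n) /\
   (~ entropic_eos D p ->
     (forall (Omega : jet -> Prop) (J : jet -> R),
        subset Omega (jets_over D) -> scalar_invariant n p Omega J ->
        locally_function_of Omega (basic_invariants n) J) /\
     (forall J : jet -> R,
        scalar_invariant n p (jets_over D) J ->
        function_of (jets_over D) (basic_invariants n) J)))
  /\
  (* (ii) *)
  (((exists (Omega : jet -> Prop) (J : jet -> R),
       subset Omega (jets_over D) /\ additional_invariant n p Omega J)
    <-> entropic_eos D p) /\
   (forall kappa : R -> R, entropic_with kappa D p ->
     (forall Omega : jet -> Prop,
        open Omega -> nonempty Omega -> subset Omega (jets_over D) ->
        additional_invariant n p Omega (inv_energy n kappa)) /\
     (forall Omega : jet -> Prop,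
        open Omega -> nonempty Omega -> subset Omega (entropic_jets n kappa D) ->
        additional_invariant n p Omega (inv_time n kappa)) /\
     (forall (Omega : jet -> Prop) (J : jet -> R),
        subset Omega (entropic_jets n kappa D) -> scalar_invariant n p Omega J ->
        locally_function_of Omega (entropic_invariants n kappa) J) /\
     (forall J : jet -> R,
        scalar_invariant n p
          (fun z => entropic_jets n kappa D z /\ 0 < z c_U) J ->
        function_of (fun z => entropic_jets n kappa D z /\ 0 < z c_U)
          (entropic_invariants n kappa) J) /\
     (forall J : jet -> R,
        scalar_invariant n p
          (fun z => entropic_jets n kappa D z /\ z c_U < 0) J ->
        function_of (fun z => entropic_jets n kappa D z /\ z c_U < 0)
          (entropic_invariants n kappa) J))).

Proof.
  assert (Hloc : ~ entropic_eos D p -> forall (Omega : jet -> Prop) (J : jet -> R),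
    subset Omega (jets_over D) -> scalar_invariant n p Omega J ->
    locally_function_of Omega (basic_invariants n) J).
  { intros hent Om J HOm HJ; apply basic_locally with D p; assumption. }
  assert (Henergy : forall kappa, entropic_with kappa D p -> forall Omega : jet -> Prop,
    open (T := fct_UniformSpace coord R_UniformSpace) Omega -> nonempty Omega ->
    subset Omega (jets_over D) -> additional_invariant n p Omega (inv_energy n kappa)).
  { intros kappa hk; apply additional_energy; assumption. }
  assert (Hglob : forall (kappa : R -> R) (sg : R), entropic_with kappa D p -> sg = 1 \/ sg = -1 ->
    forall (P : jet -> Prop), (forall z, P z <-> 0 < sg * z c_U) -> forall J,
      scalar_invariant n p (fun z => entropic_jets n kappa D z /\ P z) J ->
      function_of (fun z => entropic_jets n kappa D z /\ P z) (entropic_invariants n kappa) J).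
  { intros kappa sg hk Hsg P HP J HJ.
    apply entropic_globally with D p sg; try assumption;
      intros z [H1 H2]; split; try exact H1; apply HP, H2. }
  split; [split; [| split] | split; [split |]].
  - apply inv_S_invariant; assumption.
  - apply inv_Sr_invariant; assumption.
  - intro hent; split; [exact (Hloc hent) |].
    intros J HJ; apply basic_globally with D p; try assumption; intros z Hz; exact Hz.
  - intros (Om & J & Hs & HJ & HN); apply NNPP; intro hent; apply HN, Hloc; assumption.
  - intros [kappa hk].
    assert (open (T := fct_UniformSpace coord R_UniformSpace) (jets_over D))
      by apply jets_over_open, hD.
    exists (jets_over D), (inv_energy n kappa); split; [intros z Hz; exact Hz |].
    apply Henergy; [exact hk | assumption | | intros z Hz; exact Hz].
    (* If there were no jet over [D], then [D] would be empty and [p] vacuously constant. *)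
    apply NNPP; intro HN; apply hnonconst; exists 0; intros rho S Hd; exfalso; apply HN.
    exists (jet_of 0 1 0 rho S 0 0 0); split; [simpl; lra | exact Hd].
  - intros kappa hk; split; [exact (Henergy kappa hk) |]; split; [| split; [| split]].
    + apply additional_time; assumption.
    (* The domain may contain both signs of [U], while the straightening works for one; it is cut
       down to the open part where [U] has the sign it has at [z0]. *)
    + intros Om J HOm HJ; apply locally_function_of_mono; intros z0 Hz0.
      assert (Hsg : sign (z0 c_U) = 1 \/ sign (z0 c_U) = -1).
      { destruct (HOm z0 Hz0) as [_ [HU _]].
        destruct (Rtotal_order (z0 c_U) 0) as [H | [H | H]]; [| contradiction |].
        - right; apply sign_eq_m1, H.
        - left; apply sign_eq_1, H. }
      assert (HO : open (T := fct_UniformSpace coord R_UniformSpace)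
                     (fun z => Om z /\ 0 < sign (z0 c_U) * z c_U)).
      { apply (open_positive Om (fun z => sign (z0 c_U) * z c_U)); [apply (proj1 HJ) |].
        intros z _; apply (continuous_scal_r (sign (z0 c_U)) (fun z : coord -> R => z c_U)).
        apply continuous_coord. }
      exists (fun z => Om z /\ 0 < sign (z0 c_U) * z c_U); split; [split |split].
      * exact Hz0.
      * destruct (HOm z0 Hz0) as [_ [HU _]].
        destruct (Rtotal_order (z0 c_U) 0) as [H | [H | H]]; [| contradiction |].
        -- rewrite (sign_eq_m1 _ H); lra.
        -- rewrite (sign_eq_1 _ H); lra.
      * intros z Hz; apply Hz.
      * apply entropic_locally with D p (sign (z0 c_U)); try assumption.
        -- intros z [H1 H2]; split; [apply HOm, H1 | exact H2].
        -- apply scalar_invariant_subset with Om; [exact HO | intros z Hz; apply Hz | exact HJ].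
    + apply (Hglob kappa 1 hk); [tauto | intro z; split; intro; lra].
    + apply (Hglob kappa (-1) hk); [tauto | intro z; split; intro; lra].
Qed.
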